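(* Suppose that polynomials $A,B$ and Laurent polynomials $L_1,L_2$ satisfy the equation $$A\circ L_1=B\circ L_2$$ and the pair $A,B$ is reducible. Then there exist polynomials $R,\tilde A,\tilde B,W$ and Laurent polynomials $\tilde L_1,\tilde L_2$ such that $$A=R\circ\tilde A,\quad B=R\circ\tilde B,\quad L_1=\tilde L_1\circ W,\quad L_2=\tilde L_2\circ W,\quad \tilde A\circ\tilde L_1=\tilde B\circ\tilde L_2$$ and either the pair $\tilde A,\tilde B$ is irreducible or $$\tilde A\circ\tilde L_1\sim -T_{nl}\circ\frac12\left(\varepsilon z^m+\frac1{\varepsilon z^m}\right),\qquad \tilde B\circ\tilde L_2\sim T_{ml}\circ\frac12\left(z^n+\frac1{z^n}\right),$$ where $T_{nl},T_{ml}$ are the corresponding Chebyshev polynomials with $n,m\ge1$, $l>2$, $\varepsilon^{nl}=-1$, and $\gcd(n,m)=1$.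
   Context: All functions are nonconstant, with complex coefficients. A Laurent polynomial is a rational function all of whose poles lie in $\{0,\infty\}$. $T_k$ is the Chebyshev polynomial, $T_k(\cos\varphi)=\cos k\varphi$. A pair of polynomials $A,B$ is irreducible if the diagonal monodromy action of $\pi_1(\mathbb{CP}^1\setminus S,z_0)$ on $A^{-1}\{z_0\}\times B^{-1}\{z_0\}$ is transitive ($S$ a finite set containing the critical values of $A$ and $B$, $z_0\notin S$), equivalently if the algebraic curve $A(x)-B(y)=0$ is irreducible; otherwise the pair is reducible. For rational functions, $F_2\circ F_1\sim G_2\circ G_1$ (equivalent decompositions of the same function) means that there is a rational function $\mu$ of degree 1 with $F_2=G_2\circ\mu$, $F_1=\mu^{-1}\circ G_1$. *)

(* Defs.v *)
From HB Require Import structures.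
From mathcomp Require Import all_boot all_order all_algebra.
From mathcomp Require Import generic_quotient fraction complex reals trigo.

Set Implicit Arguments.
Unset Strict Implicit.
Unset Printing Implicit Defensive.
Import GRing.Theory Num.Theory.
Local Open Scope ring_scope.
Local Open Scope quotient_scope.

Notation ratfun K := {fraction {poly K}}.
Notation "p %:F" := (tofrac p) : ring_scope.

Lemma frac_numden (D : idomainType) (F : {fraction D}) :
  F = (\n_(repr F))%:F / (\d_(repr F))%:F.
Proof.
have d0 : \d_(repr F) != 0 by exact: denom_ratioP.
suff E : F * (\d_(repr F))%:F = (\n_(repr F))%:F.
  by rewrite -E mulfK // tofrac_eq0.
rewrite -{1}[F]reprK; unlock tofrac.
apply: (etrans (esym (FracField.pi_mul _ _))); apply/eqmodP.
rewrite /= FracField.equivfE /FracField.mulf.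
rewrite !numden_Ratio ?mulf_neq0 ?oner_neq0 //.
by rewrite !mulr1 mulrC.
Qed.

Section RationalFunctions.
Variable K : closedFieldType.
Implicit Types (p q : {poly K}) (F G H : ratfun K).

Definition ratC (c : K) : ratfun K := (c%:P)%:F.
HB.instance Definition _ := GRing.RMorphism.copy ratC (@tofrac {poly K} \o polyC).

Definition nonconstant F : Prop := forall c : K, F <> ratC c.

Definition rat_eval p G : ratfun K := (map_poly ratC p).[G].

(* F o G.  The fraction (numerator over denominator) representing F need not be
   reduced; lemma rat_compE shows that the choice is irrelevant as soon as G is
   nonconstant, the only case in which composition is used. *)
Definition rat_comp F G : ratfun K :=
  rat_eval (\n_(repr F)) G / rat_eval (\d_(repr F)) G.

(* F is finite at c : some fraction representing F has a denominator that does
   not vanish at c. *)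
Definition regular_at F (c : K) : Prop :=
  exists p q, F = p%:F / q%:F /\ q.[c] != 0.

(* All poles lie in {0, oo}; the point at infinity is unconstrained. *)
Definition Laurent F : Prop := forall c : K, c != 0 -> regular_at F c.

(* Degree of p / q in lowest terms: max (deg p) (deg q). *)
Definition rat_degree F (d : nat) : Prop :=
  exists p q, [/\ q != 0, coprimep p q, F = p%:F / q%:F
                & maxn (size p) (size q) = d.+1].

(* F2 o F1 ~ G2 o G1; here nu is the compositional inverse of mu. *)
Definition equiv_decomp F2 F1 G2 G1 : Prop :=
  exists mu nu : ratfun K,
    [/\ rat_degree mu 1,
        rat_comp mu nu = 'X%:F /\ rat_comp nu mu = 'X%:F,
        F2 = rat_comp G2 mu
      & F1 = rat_comp nu G1].

Lemma rat_eval_eq0 p G : nonconstant G -> (rat_eval p G == 0) = (p == 0).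
Proof.
move=> Gnc; apply/idP/eqP => [|->]; last by rewrite /rat_eval rmorph0 horner0.
have [r ->] := closed_field_poly_normal p.
rewrite /rat_eval map_polyZ hornerZ mulf_eq0 rmorph_prod horner_prod.
case/orP => [/eqP c0|].
  have /eqP : ratC (lead_coef p) == ratC 0 by rewrite c0 rmorph0.
  by move/eqP; rewrite /ratC tofrac_eq => /eqP/polyC_inj ->; rewrite scale0r.
rewrite prodf_seq_eq0 => /hasP[a _] /=.
by rewrite rmorphB /= map_polyX map_polyC hornerXsubC subr_eq0 => /eqP /Gnc.
Qed.

Lemma rat_compE p q G : nonconstant G -> q != 0 ->
  rat_comp (p%:F / q%:F) G = rat_eval p G / rat_eval q G.
Proof.
move=> Gnc q0; rewrite /rat_comp; set F := p%:F / q%:F.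
have d0 : \d_(repr F) != 0 by exact: denom_ratioP.
have EF : F = (\n_(repr F))%:F / (\d_(repr F))%:F by exact: frac_numden.
have /eqP : p%:F * (\d_(repr F))%:F == (\n_(repr F))%:F * q%:F.
  by rewrite -eqr_div ?tofrac_eq0 // -EF.
move/eqP; rewrite -!tofracM tofrac_eq => /eqP E.
apply/eqP; rewrite eqr_div ?rat_eval_eq0 //; apply/eqP.
by rewrite /rat_eval -!hornerM -!rmorphM /= -E.
Qed.

Lemma rat_comp_poly p q : (1 < size q)%N -> rat_comp p%:F q%:F = (p \Po q)%:F.
Proof.
move=> sq; have qnc : nonconstant q%:F.
  move=> c /eqP; rewrite /ratC tofrac_eq => /eqP E.
  by move: sq; rewrite E size_polyC; case: (c != 0).
rewrite -[p%:F]divr1 -tofrac1 rat_compE ?oner_neq0 //.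
rewrite /rat_eval rmorph1 hornerC divr1 /comp_poly -horner_map -map_poly_comp.
by [].
Qed.

(* The curve A(x) - B(y) = 0 is irreducible: A(x) - B(y) is an irreducible
   element of K[x, y].  The outer variable of {poly {poly K}} is x, the inner
   one is y.  (irreducible_poly is not used: over the coefficient ring {poly K}
   it expresses irreducibility in K(y)[x].) *)
Definition irreducible_pair (A B : {poly K}) : Prop :=
  let P : {poly {poly K}} := map_poly polyC A - B%:P in
  [/\ P != 0, P \isn't a GRing.unit
    & forall f g : {poly {poly K}}, P = f * g ->
        f \is a GRing.unit \/ g \is a GRing.unit].

Definition reducible_pair (A B : {poly K}) : Prop := ~ irreducible_pair A B.

Fixpoint chebyshev (k : nat) : {poly K} :=
  match k with
  | 0 => 1
  | k'.+1 => match k' with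
             | 0 => 'X
             | k''.+1 => 2%:R *: ('X * chebyshev k') - chebyshev k''
             end
  end.

(* (c z^k + 1 / (c z^k)) / 2 *)
Definition joukowski (c : K) (k : nat) : ratfun K :=
  let u : ratfun K := (c *: 'X^k)%:F in ratC (2%:R^-1) * (u + u^-1).

End RationalFunctions.

Arguments chebyshev {K} k.

Lemma chebyshev_cos (R : realType) (k : nat) (phi : R) :
  (chebyshev k : {poly R[i]}).[(cos phi)%:C%C] = (cos (k%:R * phi))%:C%C.
Proof.
suff: (chebyshev k : {poly R[i]}).[(cos phi)%:C%C] = (cos (k%:R * phi))%:C%C /\
  (chebyshev k.+1 : {poly R[i]}).[(cos phi)%:C%C] = (cos (k.+1%:R * phi))%:C%C.
  by case.
elim: k => [|k [IH1 IH2]].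
  by rewrite /= hornerC hornerX mul0r mul1r cos0.
split=> //; rewrite [chebyshev _]/(2%:R *: ('X * chebyshev k.+1) - chebyshev k).
rewrite hornerD hornerN hornerZ hornerM hornerX IH1 IH2.
have -> : k.+2%:R * phi = k.+1%:R * phi + phi by rewrite -natr1 mulrDl mul1r.
have -> : k%:R * phi = k.+1%:R * phi - phi.
  by rewrite -[k.+1%:R]natr1 mulrDl mul1r addrK.
rewrite cosB cosD -[2%:R](rmorph_nat (real_complex R)) -!rmorphM -rmorphB /=.
congr (_ %:C)%C.
by rewrite [cos phi * _]mulrC mulr2n mulrDl !mul1r opprD addrA addrK.
Qed.

(* Main.v *)
Require Import Defs.
From HB Require Import structures.
From mathcomp Require Import all_boot all_order all_algebra.
From mathcomp Require Import polyXY cyclic separable cyclotomic.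
From mathcomp Require Import fraction complex reals boolp ring zify.

(** Among all ways of writing A = Q o At and B = Q o Bt with At o L1 = Bt o L2,
    take one with deg Q as large as possible (primitive_exists).  If the pair
    At, Bt is irreducible there is nothing to do, so suppose that it is
    reducible and write A, B for At, Bt.

    The first step is Fried's reduction to equal degrees (splits_equal_degree):
    A = A1 o U and B = B1 o V, where deg A1 = deg B1 and A1(X) - B1(Y) is still
    reducible.  Suppose that b = deg B does not divide a = deg A.  Over the field
    of formal Laurent series in s, with t = s^(-ab), all the roots of A(X) = t and
    of B(Y) = t are available, and the substitution s |-> eta s permutes the
    former in one a-cycle and the latter in one b-cycle
    (monodromy_at_infinity).  Its a-th power fixes all roots of A(X) = t, hence
    the coefficients of any factor f(X, y) of A(X) - B(y), but not y.  By
    Lueroth's theorem (invariant_generator), these coefficients are therefore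
    polynomials in a polynomial V(y) of degree > 1, and so is B: the
    factorization descends to A(X) - B1(Y) with B = B1 o V
    (separated_descent).

    The second step compares M1 = U o L1 and M2 = V o L2, which satisfy
    A1 o M1 = B1 o M2 with deg A1 = deg B1.  At each of 0 and infinity, M1 and M2
    have poles of the same order and there is a constant c such that M1 - c M2 is
    constant up to terms that vanish there to that same order.  If one c serves
    for both points, M1 is an affine function of M2, and A1 would be a common
    left factor of A and B.  Otherwise M1 and M2 are, up to affine changes,
    (z^k + 1/z^k) / 2 for two different scalings of z (two_pole_pair).  Expanding
    A1 and B1 in Chebyshev polynomials shows that they are both polynomials in
    T_m, where m is the order of the root of unity by which the scalings differ
    (jouk_pair); since no common left factor remains, A1 and B1 are T_m up to
    affine changes and signs.  The case m = 2 is excluded because X^2 + Y^2 - 1 is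
    irreducible.

    Consequently A o L1 = B o L2 is z^N + 1/z^N up to an affine change, and the
    same comparison of polynomials of equal degree, applied to A and T_a, shows
    that A is T_a or - T_a and L1 is z^s + 1/z^s up to affine changes
    (jouk_decomposition); likewise for B and L2.  What is left is to arrange the
    signs, where primitivity is used once more (opposite_signs), and to extract
    the common right factor z^w (chebyshev_pair_normal_form). *)

Set Implicit Arguments.
Unset Strict Implicit.
Unset Printing Implicit Defensive.
Import GRing.Theory Num.Theory.
Local Open Scope ring_scope.

(** * Formal power series *)

Record series (K : Type) := Series { coefs : nat -> K }.

HB.instance Definition _ (K : Type) := gen_eqMixin (series K).
HB.instance Definition _ (K : Type) := gen_choiceMixin (series K).

Section SeriesRing.
Variable K : idomainType.
Implicit Types (f g h : series K) (p q : {poly K}).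

Lemma seriesP f g : (forall n, coefs f n = coefs g n) -> f = g.
Proof. by case: f g => [f] [g] /= E; congr Series; apply/funext. Qed.

Definition series_add f g := Series (fun n => coefs f n + coefs g n).
Definition series_opp f := Series (fun n => - coefs f n).
Definition series_mul f g :=
  Series (fun n => \sum_(i < n.+1) coefs f i * coefs g (n - i)%N).
Definition poly_series p := Series (fun n => p`_n).

(** Every identity between series is checked one coefficient at a time, on
    polynomials agreeing with the series up to the order under consideration;
    this imports associativity and the like from polynomials. *)
Definition agree n p f := forall i, (i <= n)%N -> p`_i = coefs f i.

Lemma agree_trunc n f : agree n (\poly_(i < n.+1) coefs f i) f.
Proof. by move=> i le_in; rewrite coef_poly ltnS le_in. Qed.

Lemma agreeM n p q f g :
  agree n p f -> agree n q g -> agree n (p * q) (series_mul f g).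
Proof.
move=> pf qg i le_in; rewrite coefM; apply: eq_bigr => j _.
by rewrite pf ?qg //; [apply: leq_trans (leq_subr _ _) _
                      |apply: leq_trans le_in; rewrite -ltnS].
Qed.

Lemma agreeD n p q f g :
  agree n p f -> agree n q g -> agree n (p + q) (series_add f g).
Proof. by move=> pf qg i le_in; rewrite coefD pf ?qg. Qed.

Fact series_addA : associative series_add.
Proof. by move=> f g h; apply: seriesP => n /=; rewrite addrA. Qed.
Fact series_addC : commutative series_add.
Proof. by move=> f g; apply: seriesP => n /=; rewrite addrC. Qed.
Fact series_add0 : left_id (poly_series 0) series_add.
Proof. by move=> f; apply: seriesP => n /=; rewrite coef0 add0r. Qed.
Fact series_addN : left_inverse (poly_series 0) series_opp series_add.
Proof. by move=> f; apply: seriesP => n /=; rewrite coef0 addNr. Qed.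
HB.instance Definition _ := GRing.isZmodule.Build (series K)
  series_addA series_addC series_add0 series_addN.

Fact series_mulA : associative series_mul.
Proof.
move=> f g h; apply: seriesP => n.
pose T (u : series K) := \poly_(i < n.+1) coefs u i.
have aT u : agree n (T u) u by exact: agree_trunc.
rewrite -(agreeM (aT f) (agreeM (aT g) (aT h)) (leqnn n)).
by rewrite -(agreeM (agreeM (aT f) (aT g)) (aT h) (leqnn n)) mulrA.
Qed.
Fact series_mulC : commutative series_mul.
Proof.
move=> f g; apply: seriesP => n.
rewrite -(agreeM (@agree_trunc n f) (@agree_trunc n g) (leqnn n)).
by rewrite -(agreeM (@agree_trunc n g) (@agree_trunc n f) (leqnn n)) mulrC.
Qed.
Fact series_mul1 : left_id (poly_series 1) series_mul.
Proof.
move=> f; apply: seriesP => n.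
have a1 : agree n 1 (poly_series 1) by [].
by rewrite -(agreeM a1 (@agree_trunc n f) (leqnn n)) mul1r agree_trunc.
Qed.
Fact series_mulDl : left_distributive series_mul series_add.
Proof.
move=> f g h; apply: seriesP => n.
pose T (u : series K) := \poly_(i < n.+1) coefs u i.
have aT u : agree n (T u) u by exact: agree_trunc.
rewrite -(agreeM (agreeD (aT f) (aT g)) (aT h) (leqnn n)) mulrDl.
by rewrite -(agreeD (agreeM (aT f) (aT h)) (agreeM (aT g) (aT h)) (leqnn n)).
Qed.
Fact series_oner_neq0 : poly_series 1 != 0 :> series K.
Proof.
apply/eqP => /(congr1 (fun f => coefs f 0)) /=.
by rewrite coef0 coefC eqxx => /eqP; rewrite oner_eq0.
Qed.
HB.instance Definition _ := GRing.Zmodule_isComNzRing.Build (series K)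
  series_mulA series_mulC series_mul1 series_mulDl series_oner_neq0.

Lemma coefs0 n : coefs (0 : series K) n = 0. Proof. exact: coef0. Qed.
Lemma coefsB f g n : coefs (f - g) n = coefs f n - coefs g n. Proof. by []. Qed.
Lemma coefsM f g n :
  coefs (f * g) n = \sum_(i < n.+1) coefs f i * coefs g (n - i)%N.
Proof. by []. Qed.

Fact poly_series_zmod : zmod_morphism poly_series.
Proof. by move=> p q; apply: seriesP => n; rewrite coefsB /= coefB. Qed.
Fact poly_series_monoid : monoid_morphism poly_series.
Proof. by split=> // p q; apply: seriesP => n; rewrite coefsM /= coefM. Qed.
HB.instance Definition _ :=
  GRing.isZmodMorphism.Build {poly K} (series K) poly_series poly_series_zmod.
HB.instance Definition _ :=
  GRing.isMonoidMorphism.Build {poly K} (series K) poly_series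
    poly_series_monoid.

Lemma poly_series_inj : injective poly_series.
Proof. by move=> p q /(congr1 (@coefs K)) E; apply/polyP => n;
  move/(congr1 (@^~ n)): E. Qed.

(** Inverses are chosen classically: only the field of fractions matters. *)
Definition series_unit : pred (series K) := fun f => `[< exists g, g * f = 1 >].
Definition series_inv f : series K :=
  if pselect (exists g, g * f = 1) is left e then projT1 (cid e) else f.

Fact series_mulVx : {in series_unit, left_inverse 1 series_inv *%R}.
Proof.
move=> f /asboolP uf; rewrite /series_inv; case: pselect => // e.
exact: projT2 (cid e).
Qed.
Fact series_unitPl f g : g * f = 1 -> series_unit f.
Proof. by move=> E; apply/asboolP; exists g. Qed.
Fact series_inv_out : {in [predC series_unit], series_inv =1 id}.
Proof.
move=> f; rewrite inE /= => nu; rewrite /series_inv; case: pselect => // e.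
by case/negP: nu; apply/asboolP.
Qed.
HB.instance Definition _ := GRing.ComNzRing_hasMulInverse.Build (series K)
  series_mulVx series_unitPl series_inv_out.

Lemma series_neq0 f : f != 0 ->
  exists n, coefs f n != 0 /\ forall i, (i < n)%N -> coefs f i = 0.
Proof.
move=> f0; have ex : exists n, coefs f n != 0.
  apply: contrapT => E; case/eqP: f0; apply: seriesP => n; rewrite coefs0.
  by apply/eqP/negPn/negP => fn; apply: E; exists n.
exists (ex_minn ex); case: ex_minnP => n fn min; split=> // i lt_in.
by apply/eqP/negPn/negP => /min; rewrite leqNgt lt_in.
Qed.

Fact series_idomain : GRing.integral_domain_axiom (series K).
Proof.
move=> f g fg0; apply/norP =>
  -[/series_neq0[m [fm f_lt]] /series_neq0[n [gn g_lt]]].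
move/(congr1 (fun h => coefs h (m + n)%N)): fg0; rewrite coefs0 coefsM.
have lt_m : (m < (m + n).+1)%N by rewrite ltnS leq_addr.
rewrite (bigD1 (Ordinal lt_m)) //= addKn big1 ?addr0.
  by move/eqP; rewrite mulf_eq0 (negbTE fm) (negbTE gn).
move=> i; rewrite -val_eqE /= => ne_im.
have [lt_im|gt_im|E] := ltngtP i m; last by rewrite E eqxx in ne_im.
  by rewrite f_lt ?mul0r.
by rewrite g_lt ?mulr0 // ltn_subLR ?ltn_add2r // -ltnS ltn_ord.
Qed.
HB.instance Definition _ :=
  GRing.ComUnitRing_isIntegral.Build (series K) series_idomain.

(** The substitution f(s) |-> f(eta s). *)
Definition dilate (eta : K) f : series K :=
  Series (fun n => eta ^+ n * coefs f n).

Fact dilate_zmod eta : zmod_morphism (dilate eta).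
Proof. by move=> f g; apply: seriesP => n; rewrite coefsB /= -mulrBr. Qed.
Fact dilate_monoid eta : monoid_morphism (dilate eta).
Proof.
split=> [|f g]; apply: seriesP => n.
  by rewrite /= coefC; case: n => [|n]; rewrite /= ?mulr1 ?mulr0.
rewrite coefsM /= big_distrr /=; apply: eq_bigr => i _.
rewrite -{1}(subnKC (leq_ord i)) exprD -!mulrA; congr (_ * _).
by rewrite mulrCA.
Qed.
HB.instance Definition _ eta := GRing.isZmodMorphism.Build
  (series K) (series K) (dilate eta) (dilate_zmod eta).
HB.instance Definition _ eta := GRing.isMonoidMorphism.Build
  (series K) (series K) (dilate eta) (dilate_monoid eta).

Lemma dilate_inj eta : eta != 0 -> injective (dilate eta).
Proof.
move=> eta0 f g E; apply: seriesP => n.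
move/(congr1 (fun h => coefs h n)): E => /=.
by apply: mulfI; rewrite expf_neq0.
Qed.

Lemma dilate_poly eta p : dilate eta (poly_series p)
  = poly_series (p \Po (eta *: 'X)).
Proof.
apply: seriesP => n /=; rewrite comp_polyE coef_sum.
under eq_bigr => i _ do rewrite exprZn scalerA coefZ coefXn.
have [le_n|lt_n] := leqP (size p) n.
  rewrite nth_default // mulr0 big1 // => i _.
  by rewrite [n == i]gtn_eqF ?mulr0 // (leq_trans (ltn_ord i)).
rewrite (bigD1 (Ordinal lt_n)) //= eqxx mulr1 big1 ?addr0 1?mulrC // => i.
by rewrite -val_eqE /= eq_sym => /negbTE ->; rewrite mulr0.
Qed.

End SeriesRing.

Lemma horner_sub_factor (R : comNzRingType) (p : {poly R}) (x y : R) :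
  exists u, p.[x] - p.[y] = (x - y) * u.
Proof.
have /factor_theorem[q E] : root (p - p.[y]%:P) y.
  by rewrite rootE hornerD hornerN hornerC subrr.
move/(congr1 (horner^~ x)): E.
rewrite hornerM hornerD hornerN hornerC hornerXsubC => ->.
by exists q.[x]; rewrite mulrC.
Qed.

(** * Extending an injective morphism to the fields of fractions *)

Section FractionMap.
Variables (D D' : idomainType) (phi : {rmorphism D -> D'}).
Hypothesis phi_inj : injective phi.

(** The proof of injectivity is an argument, so that the morphism structure can
   be inferred from frac_map itself. *)
Definition frac_map (F : {fraction D}) : {fraction D'} :=
  let _ := phi_inj in
  (phi \n_(repr F))%:F / (phi \d_(repr F))%:F.

Lemma frac_mapE p q : q != 0
  -> frac_map (p%:F / q%:F) = (phi p)%:F / (phi q)%:F.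
Proof.
move=> q0; rewrite /frac_map /=; set F := p%:F / q%:F.
have d0 : \d_(repr F) != 0 by exact: denom_ratioP.
have /eqP : p%:F * (\d_(repr F))%:F == (\n_(repr F))%:F * q%:F.
  by rewrite -eqr_div ?tofrac_eq0 // -frac_numden.
rewrite -!tofracM => /eqP; rewrite tofrac_eq => /eqP E.
have phi0 u : u != 0 -> (phi u)%:F != 0.
  by move=> u0; rewrite tofrac_eq0 (raddf_eq0 _ phi_inj).
by apply/eqP; rewrite eqr_div ?phi0 // -!tofracM -!rmorphM /= -E.
Qed.

Lemma frac_map_tofrac p : frac_map p%:F = (phi p)%:F.
Proof. by rewrite -[p%:F]divr1 -tofrac1 frac_mapE
  ?oner_neq0 // rmorph1 divr1. Qed.

Fact frac_map_zmod : zmod_morphism frac_map.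
Proof.
move=> F G; rewrite [F]frac_numden [G]frac_numden.
have := denom_ratioP (repr F); have := denom_ratioP (repr G).
set p := \n_(repr F); set q := \d_(repr F); set u := \n_(repr G);
  set v := \d_(repr G).
move=> v0 q0; have F0 w : w != 0
  -> w%:F != 0 :> {fraction D} by rewrite tofrac_eq0.
have phi0 w : w != 0 -> (phi w)%:F != 0.
  by move=> w0; rewrite tofrac_eq0 (raddf_eq0 _ phi_inj).
rewrite -mulNr addf_div ?F0 // -tofracN -!tofracM -tofracD !frac_mapE
  ?mulf_neq0 //.
by rewrite -[in RHS]mulNr [RHS]addf_div ?phi0 // -!rmorphN -!rmorphM -!rmorphD.
Qed.
Fact frac_map_monoid : monoid_morphism frac_map.
Proof.
split=> [|F G]; first by rewrite -tofrac1 frac_map_tofrac rmorph1.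
rewrite [F]frac_numden [G]frac_numden.
have := denom_ratioP (repr F); have := denom_ratioP (repr G).
set p := \n_(repr F); set q := \d_(repr F); set u := \n_(repr G);
  set v := \d_(repr G).
move=> v0 q0; rewrite mulf_div -!tofracM !frac_mapE ?mulf_neq0 //.
by rewrite mulf_div -!tofracM -!rmorphM.
Qed.
HB.instance Definition _ := GRing.isZmodMorphism.Build
  {fraction D} {fraction D'} frac_map frac_map_zmod.
HB.instance Definition _ := GRing.isMonoidMorphism.Build
  {fraction D} {fraction D'} frac_map frac_map_monoid.
End FractionMap.

(** * Roots of polynomials at infinity *)

Section Contraction.
Variable K : idomainType.
Implicit Types f g : series K.

Definition series_cst (c : K) : series K := poly_series c%:P.
HB.instance Definition _ :=
  GRing.RMorphism.copy series_cst (@poly_series K \o polyC).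

Definition const_term f := coefs f 0.
Fact const_term_zmod : zmod_morphism const_term. Proof. by []. Qed.
Fact const_term_monoid : monoid_morphism const_term.
Proof.
split; first by rewrite /const_term /= coefC.
by move=> f g; rewrite /const_term coefsM big_ord1.
Qed.
HB.instance Definition _ :=
  GRing.isZmodMorphism.Build (series K) K const_term const_term_zmod.
HB.instance Definition _ :=
  GRing.isMonoidMorphism.Build (series K) K const_term const_term_monoid.

Arguments const_term : simpl never.

Lemma const_term_cst c : const_term (series_cst c) = c.
Proof. by rewrite /const_term /= coefC. Qed.

Definition sX : series K := poly_series 'X.

Lemma coefs_sXnM n f i :
  coefs (sX ^+ n * f) i = if (i < n)%N then 0 else coefs f (i - n)%N.
Proof.
rewrite /sX -rmorphXn coefsM; case: ltnP => [lt_in|le_ni].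
  rewrite big1 // => j _; rewrite /= coefXn ltn_eqF ?mul0r //.
  by apply: leq_ltn_trans lt_in; rewrite -ltnS.
have lt_n : (n < i.+1)%N by rewrite ltnS.
rewrite (bigD1 (Ordinal lt_n)) //= coefXn eqxx mul1r big1 ?addr0 //.
by move=> j; rewrite -val_eqE /= coefXn => /negbTE ->; rewrite mul0r.
Qed.

Definition scong n f g := exists h, f - g = sX ^+ n * h.

Lemma scongP n f g : scong n f g <-> forall i, (i < n)%N
  -> coefs f i = coefs g i.
Proof.
split=> [[h E] i lt_in|E].
  by apply/eqP; rewrite -subr_eq0 -coefsB E coefs_sXnM lt_in.
exists (Series (fun i => coefs (f - g) (i + n)%N)); apply: seriesP => i.
rewrite coefs_sXnM; case: ltnP => [lt_in|le_ni]; last by rewrite /= subnK.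
by rewrite coefsB E ?subrr.
Qed.

Lemma const_term0 f : const_term f = 0 -> exists h, f = sX * h.
Proof.
move=> f0; have /scongP[h] : forall i, (i < 1)%N -> coefs f i = coefs 0 i.
  by case=> // _; rewrite coefs0.
by rewrite subr0 expr1 => ->; exists h.
Qed.

End Contraction.
Arguments const_term {K} f : simpl never.

Section Branch.
Variable K : numClosedFieldType.

(** The branch is the fixed point of the Newton-like contraction
    w |-> w - (w^a - q(s^N w)) / (a r^(a-1)), r being an a-th root of q(0). *)
Lemma branch_exists (q : {poly K}) (a N : nat) : (0 < a)%N -> (0 < N)%N ->
  q.[0] != 0 -> exists w : series K, const_term w != 0 /\
    w ^+ a = (map_poly (@series_cst K) q).[sX K ^+ N * w].
Proof.
move=> a_gt0 N_gt0 q0; set qs := map_poly _ q.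
pose r := a.-root q.[0].
have ra : r ^+ a = q.[0] by rewrite rootCK.
have r0 : r != 0 by apply: contraNneq q0 => r0; rewrite -ra r0 expr0n gtn_eqF.
pose kap := (r ^+ a.-1 *+ a)^-1.
have kap0 : r ^+ a.-1 *+ a != 0 by rewrite mulrn_eq0 negb_or -lt0n a_gt0 expf_neq0.
pose T (w : series K) := w - series_cst kap * (w ^+ a - qs.[sX K ^+ N * w]).
have ctS f : const_term (sX K * f) = 0.
  by rewrite rmorphM /= /const_term /= coefX mul0r.
have ctSN f : const_term (sX K ^+ N * f) = 0.
  by rewrite -(prednK N_gt0) exprS -mulrA ctS.
have ctq f : const_term qs.[sX K ^+ N * f] = q.[0].
  rewrite -horner_map /= ctSN -map_poly_comp; congr _.[_].
  by rewrite map_poly_id // => c _; exact: const_term_cst.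
have T_ct f : const_term f = r -> const_term (T f) = r.
  by move=> fr; rewrite rmorphB rmorphM rmorphB rmorphXn /= fr ctq ra subrr mulr0 subr0.
have contr n f g : const_term f = r -> const_term g = r ->
    scong n f g -> scong n.+1 (T f) (T g).
  move=> fr gr [h E]; pose S := \sum_(i < a) f ^+ (a.-1 - i) * g ^+ i.
  have ES : f ^+ a - g ^+ a = (f - g) * S by exact: subrXX.
  have [u Eu] : exists u, 1 - series_cst kap * S = sX K * u.
    apply: const_term0; rewrite rmorphB rmorph1 rmorphM rmorph_sum /= const_term_cst.
    under eq_bigr => i _.
      rewrite rmorphM !rmorphXn /= fr gr -exprD subnK; last first.
        by rewrite -ltnS prednK.
      over.
    by rewrite sumr_const card_ord mulVf ?subrr.
  have [v Ev] := horner_sub_factor qs (sX K ^+ N * f) (sX K ^+ N * g).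
  rewrite -mulrBr in Ev.
  exists (h * u + series_cst kap * sX K ^+ N.-1 * h * v).
  have -> : T f - T g = (f - g) * (1 - series_cst kap * S)
                    + series_cst kap * (qs.[sX K ^+ N * f] - qs.[sX K ^+ N
                      * g]).
    by rewrite mulrBr mulr1 [(f - g) * (_ * S)]mulrCA -ES /T; ring.
  rewrite Eu Ev E -{1}(prednK N_gt0) !exprS; ring.
pose w_ n := iter n T (series_cst r).
have w_ct n : const_term (w_ n) = r.
  by elim: n => [|n IHn]; rewrite ?const_term_cst //= T_ct.
have wS n : scong n.+1 (w_ n.+1) (w_ n).
  elim: n => [|n IHn]; last exact: contr (w_ct _) (w_ct _) IHn.
  by apply/scongP; case=> // _;
    rewrite -[LHS]/(const_term _) w_ct -[RHS]/(const_term _) w_ct.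
have wm n m i : (i <= n)%N -> coefs (w_ (n + m)%N) i = coefs (w_ n) i.
  move=> le_in; elim: m => [|m IHm]; first by rewrite addn0.
  rewrite addnS -IHm; have /scongP -> // := wS (n + m)%N.
  by rewrite ltnS (leq_trans le_in) ?leq_addr.
pose w := Series (fun n => coefs (w_ n) n).
have ww n : scong n.+1 w (w_ n).
  by apply/scongP => i; rewrite ltnS => le_in; rewrite -(subnKC le_in) wm.
have ctw : const_term w = r by rewrite -(w_ct 0%N).
exists w; split; first by rewrite ctw.
have Tw : T w = w.
  apply: seriesP => n; have /scongP -> := contr _ _ _ ctw (w_ct n) (ww n);
    last by [].
  by have /scongP -> := wS n.
move/eqP: Tw; rewrite /T -subr_eq0 addrAC subrr sub0r oppr_eq0 mulf_eq0.
rewrite subr_eq0 => /orP[/eqP E|/eqP //].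
have : kap != 0 by rewrite invr_eq0.
by rewrite -(const_term_cst kap) E rmorph0 eqxx.
Qed.
End Branch.

Lemma prim_root_exists (K : numClosedFieldType) n : (0 < n)%N ->
  exists z : K, n.-primitive_root z.
Proof.
move=> n_gt0; pose p : {poly K} := 'X^n - 1;
  have [r Dp] := closed_field_poly_normal p.
rewrite (monicP _) ?monicXnsubC // scale1r in Dp.
have rn1 : all n.-unity_root r by apply/allP => z; rewrite -root_prod_XsubC -Dp.
have sz_r : (n < (size r).+1)%N.
  by rewrite -(size_prod_XsubC r id) -Dp size_XnsubC.
have [|z] := hasP (has_prim_root n_gt0 rn1 _ sz_r); last by exists z.
by rewrite -separable_prod_XsubC -Dp separable_Xn_sub_1 // pnatr_eq0 -lt0n.
Qed.

Section Monodromy.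
Variable K : numClosedFieldType.
Implicit Types (A B p q : {poly K}).

Let E : fieldType := {fraction (series K)}.

Definition laurent_cst (c : K) : E := (series_cst c)%:F.
HB.instance Definition _ := GRing.RMorphism.copy laurent_cst
  (@tofrac (series K) \o @series_cst K).

Lemma sX_neq0 : sX K != 0.
Proof.
by rewrite /sX -(rmorph0 (@poly_series K)) (inj_eq (@poly_series_inj K)) polyX_eq0.
Qed.

(** In the variable w = 1/(s^N x) the equation A(x) = s^(-Na) becomes
    w^a = q(s^N w), where q is A with its coefficients reversed. *)
Lemma branch_pole A a N : size A = a.+1 -> (0 < a)%N -> (0 < N)%N ->
  exists w : series K, const_term w != 0 /\
    (map_poly laurent_cst A).[(sX K ^+ N * w)%:F^-1] = (sX K ^+ (N * a))%:F^-1.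
Proof.
move=> sA a_gt0 N_gt0; pose q := \poly_(j < a.+1) A`_(a - j).
have q0 : q.[0] != 0.
  rewrite horner_coef0 coef_poly subn0; have := lead_coef_eq0 A.
  by rewrite lead_coefE sA /= -size_poly_eq0 sA => ->.
have [w [w0 Ew]] := branch_exists a_gt0 N_gt0 q0; exists w; split=> //.
have wn0 : w != 0 by apply: contraNneq w0 => ->; rewrite rmorph0.
set u := sX K ^+ N * w in Ew *.
have u0 : u%:F != 0 :> E by rewrite tofrac_eq0 mulf_neq0 ?expf_neq0 ?sX_neq0.
have -> : (sX K ^+ (N * a))%:F^-1 = (w ^+ a)%:F / u%:F ^+ a :> E.
  rewrite -tofracXn /u exprMn -exprM tofracM invfM mulrCA mulfV ?mulr1 //.
  by rewrite tofrac_eq0 expf_neq0.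
apply: canRL (mulfK _) _; first by rewrite expf_neq0.
rewrite Ew (@horner_coef_wide _ a.+1); last first.
  by rewrite size_map_poly sA.
rewrite (@horner_coef_wide _ a.+1); last by rewrite size_map_poly size_poly.
rewrite big_distrl rmorph_sum [RHS](reindex_inj rev_ord_inj) /=.
apply: eq_bigr => i _; have le_ia : (i <= a)%N by rewrite -ltnS.
rewrite !coef_map /= coef_poly subSS ltnS leq_subr subKn //
  [RHS]tofracM tofracXn.
rewrite -mulrA; congr (_ * _);
  rewrite -[X in _ * _ ^+ X](subnK le_ia) exprD mulrCA.
by rewrite -exprMn mulVf // expr1n mulr1.
Qed.

(** The monodromy at infinity.  Over the field of formal Laurent series in s,
    where t = s^(-ab), the equation A(x) = t has the root 1/(s^b w) with w
    invertible; the substitution s |-> eta s, for a primitive ab-th root of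
    unity eta, multiplies its leading coefficient by a primitive a-th root of
    unity, so it permutes the a roots of A(x) = t in a single cycle; likewise
    for B. *)
Lemma monodromy_at_infinity A B a b :
  size A = a.+1 -> size B = b.+1 -> (0 < a)%N -> (0 < b)%N ->
  exists (F : fieldType) (iota : {rmorphism K
    -> F}) (sigma : {rmorphism F -> F})
    (t x y : F),
    [/\ forall c, sigma (iota c) = iota c,
        forall p, p != 0 -> (map_poly iota p).[y] != 0,
        [/\ sigma t = t, (map_poly iota A).[x] = t & (map_poly iota B).[y] = t],
        forall i, (iter i sigma x == x) = (a %| i)%N
      & forall i, (iter i sigma y == y) = (b %| i)%N].
Proof.
move=> sA sB a_gt0 b_gt0.
have ab_gt0 : (0 < a * b)%N by rewrite muln_gt0 a_gt0.
have [eta eta_prim] := prim_root_exists K ab_gt0.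
have eta0 : eta != 0 by rewrite (prim_root_eq0 eta_prim) -lt0n.
pose sigma : {rmorphism E -> E} := frac_map (dilate_inj eta0).
have sigE (f : series K) : sigma f%:F
  = (dilate eta f)%:F by exact: frac_map_tofrac.
have dilX : dilate eta (sX K) = series_cst eta * sX K.
  by rewrite /sX dilate_poly comp_polyX -mul_polyC rmorphM.
have dilC c : dilate eta (series_cst c) = series_cst c.
  by rewrite /series_cst dilate_poly comp_polyC.
have sigC c : sigma (laurent_cst c) = laurent_cst c by rewrite sigE dilC.
pose t : E := (sX K ^+ (a * b))%:F^-1.
have sigt : sigma t = t.
  rewrite fmorphV sigE rmorphXn /= dilX exprMn -rmorphXn /=.
  by rewrite (prim_expr_order eta_prim) rmorph1 mul1r.
have ct_iter i w : const_term (iter i (dilate eta) w) = const_term w.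
  by elim: i => //= i <-; rewrite {1}/const_term /= mul1r.
(* Conjugates of a root are told apart by their leading coefficients. *)
have orbit (C : {poly K}) c N : size C = c.+1 -> (0 < c)%N -> (0 < N)%N
  -> (N * c = a * b)%N ->
    exists x, (map_poly laurent_cst C).[x] = t
              /\ forall i, (iter i sigma x == x) = (c %| i)%N.
  move=> sC c_gt0 N_gt0 Nc.
  have [w [w0 Ew]] := branch_pole sC c_gt0 N_gt0; rewrite Nc -/t in Ew.
  exists (sX K ^+ N * w)%:F^-1; split=> //.
  set x := _%:F^-1 in Ew *.
  have wn0 : w != 0 by apply: contraNneq w0 => ->; rewrite rmorph0.
  have iterE i : iter i sigma x
      = (sX K ^+ N * (series_cst (eta ^+ (N * i))
        * iter i (dilate eta) w))%:F^-1.
    elim: i => [|i IHi]; first by rewrite muln0 expr0 rmorph1 mul1r.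
    rewrite iterS IHi fmorphV sigE; congr (_%:F^-1).
    rewrite [LHS]rmorphM rmorphXn /= dilX exprMn -mulrA mulrCA; congr (_ * _).
    rewrite [dilate _ _]rmorphM /= dilC mulrA -rmorphXn -rmorphM -exprD.
    by rewrite mulnS.
  have lead_eq i j : iter i sigma x = iter j sigma x -> i = j %[mod c].
    rewrite !iterE => /invr_inj/eqP; rewrite tofrac_eq => /eqP.
    move/(mulfI (expf_neq0 N sX_neq0))/(congr1 const_term).
    rewrite !rmorphM /= !ct_iter !const_term_cst => /(mulIf w0)/eqP.
    rewrite (eq_prim_root_expr eta_prim) -Nc -!muln_modr eqn_pmul2l // => /eqP.
    by [].
  have rootx i : (map_poly laurent_cst C).[iter i sigma x] = t.
    elim: i => //= i IHi; rewrite -sigt -IHi -horner_map /= -map_poly_comp.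
    by congr _.[_]; apply: eq_map_poly => z; rewrite /= sigC.
  have Ur : uniq [seq iter i sigma x | i <- iota 0 c].
    rewrite map_inj_in_uniq ?iota_uniq // => i j.
    rewrite !mem_iota !add0n => /= lt_ic lt_jc /lead_eq.
    by rewrite !modn_small.
  have szC : size (map_poly laurent_cst C - t%:P) = c.+1.
    rewrite size_polyDl ?size_map_poly ?sC //.
    by rewrite size_polyN (leq_ltn_trans (size_polyC_leq1 _)).
  have C0 : map_poly laurent_cst C - t%:P != 0 by rewrite -size_poly_eq0 szC.
  have cycx : iter c sigma x = x.
    have rt i : root (map_poly laurent_cst C - t%:P) (iter i sigma x).
      by rewrite rootE hornerD hornerN hornerC rootx subrr.
    have : iter c sigma x \in [seq iter i sigma x | i <- iota 0 c].
      apply: contraT => nin.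
      have := @max_poly_roots _ _ (iter c sigma x :: _) C0 _ _.
      move/(_ [seq iter i sigma x | i <- iota 0 c]).
      rewrite /= nin Ur size_map size_iota szC ltnn; apply=> //.
      by rewrite rt; apply/allP => _ /mapP[i _ ->]; apply: rt.
    case/mapP => i; rewrite mem_iota => /= lt_ic E1.
    have := lead_eq _ _ E1; rewrite modnn modn_small // => i0.
    by rewrite E1 -i0.
  move=> i; apply/eqP/idP => [/(lead_eq i 0)|/dvdnP[k ->]].
    by rewrite mod0n => /eqP.
  by elim: k => // k IHk; rewrite mulSn iterD IHk.
have [x [Ex Ox]] := orbit A a b sA a_gt0 b_gt0 (mulnC b a).
have [y [Ey Oy]] := orbit B b a sB b_gt0 a_gt0 erefl.
exists E, laurent_cst, sigma, t, x, y; split=> // p p0.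
have [r ->] := closed_field_poly_normal p.
rewrite map_polyZ hornerZ mulf_neq0 //;
  first by rewrite fmorph_eq0 lead_coef_eq0.
rewrite rmorph_prod horner_prod prodf_seq_neq0; apply/allP => c _ /=.
rewrite rmorphB /= map_polyX map_polyC hornerXsubC subr_eq0 /=.
(* A constant y would make t constant. *)
apply/eqP => yc; move: Ey; rewrite yc horner_map /=.
move/(congr1 ( *%R (sX K ^+ (a * b))%:F)).
rewrite divff ?tofrac_eq0 ?expf_neq0 ?sX_neq0 // -tofracM -tofrac1 => /eqP.
rewrite tofrac_eq.
rewrite /sX /series_cst -rmorphXn -rmorphM -(rmorph1 (@poly_series K)).
rewrite (inj_eq (@poly_series_inj K)) => /eqP/(congr1 (horner^~ 0)).
rewrite hornerM hornerXn expr0n !hornerE /=; case: (a * b)%N ab_gt0 => //= _ _.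
by rewrite mul0r => /esym/eqP; rewrite oner_eq0.
Qed.
End Monodromy.

(** * Separated polynomials and the polynomial form of Lueroth's theorem *)

Section IterMorphism.
Variables (R : nzRingType) (sigma : {rmorphism R -> R}) (n : nat).
Definition iterm : R -> R := iter n sigma.
Fact iterm_zmod : zmod_morphism iterm.
Proof. by rewrite /iterm => u v; elim: n => //= i ->; rewrite rmorphB. Qed.
Fact iterm_monoid : monoid_morphism iterm.
Proof.
rewrite /iterm; split=> [|u v]; elim: n => //= i ->; rewrite ?rmorph1 //.
by rewrite rmorphM.
Qed.
HB.instance Definition _ := GRing.isZmodMorphism.Build R R iterm iterm_zmod.
HB.instance Definition _ := GRing.isMonoidMorphism.Build R R iterm iterm_monoid.
End IterMorphism.

Section Separated.
Variable K : closedFieldType.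
Implicit Types (A B p : {poly K}) (P Q f g : {poly {poly K}}).

(** The outer variable is X, as in irreducible_pair. *)
Definition sepp A B : {poly {poly K}} := map_poly polyC A - B%:P.

Lemma size_sepp A B : (1 < size A)%N -> size (sepp A B) = size A.
Proof.
move=> sA; rewrite size_polyDl size_map_polyC // size_polyN.
exact: leq_ltn_trans (size_polyC_leq1 _) sA.
Qed.

Lemma lead_coef_sepp A B : (1 < size A)%N ->
  lead_coef (sepp A B) = (lead_coef A)%:P.
Proof.
move=> sA; rewrite lead_coefDl ?lead_coef_map_inj //; first exact: polyC_inj.
by rewrite size_map_polyC size_polyN (leq_ltn_trans (size_polyC_leq1 _) sA).
Qed.

Lemma swapXY_sepp A B : swapXY (sepp A B) = - sepp B A.
Proof. by rewrite /sepp raddfB /= swapXY_map_polyC swapXY_polyC opprB. Qed.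

Lemma unit_polypoly P : (P \is a GRing.unit) =
  (size P == 1%N) && (size P`_0 == 1%N).
Proof.
rewrite poly_unitE; case: eqP => //= sP; rewrite poly_unitE.
case: eqP => //= /eqP s0; rewrite unitfE.
by have /size_poly1P[z z0 ->] := s0; rewrite coefC.
Qed.

(** Gauss's lemma, by removing the roots of delta one at a time: a product
    vanishing at a root of delta has a factor vanishing there. *)
Lemma gauss_factor (delta : {poly K}) Q P1 P2 : delta != 0 ->
  delta *: Q = P1 * P2 ->
  exists d P1' P2', [/\ d != 0, P1 = d *: P1' & Q = P1' * P2'].
Proof.
have vanish P r : map_poly (horner_eval r) P = 0
  -> exists P', P = ('X - r%:P) *: P'.
  move=> P0; exists (map_poly (fun c => c %/ ('X - r%:P)) P).
  apply/polyP => i; rewrite coefZ coef_map_id0 ?div0p //.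
  rewrite mulrC divpK // dvdp_XsubCl rootE -/(horner_eval r _).
  by rewrite -(coef_map (horner_eval r)) P0 coef0.
have [n] := ubnP (size delta).
elim: n delta P1 P2 => // n IHn delta P1 P2; rewrite ltnS => sd d0 E.
have [s1|s1] := leqP (size delta) 1.
  have /size_poly1P[z z0 Dz] : size delta == 1%N.
    by rewrite eqn_leq s1 lt0n size_poly_eq0.
  exists 1, P1, ((z^-1)%:P *: P2); split; rewrite ?oner_neq0 ?scale1r //.
  by rewrite -scalerAr -E Dz scalerA -rmorphM mulVf // rmorph1 scale1r.
have [r rd] : exists r, root delta r by apply/closed_rootP; rewrite gtn_eqF.
have [delta' Dd] := factor_theorem _ _ rd.
have d'0 : delta' != 0 by apply: contraNneq d0 => E'; rewrite Dd E' mul0r.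
have sd' : (size delta' < n)%N.
  by apply: leq_trans sd;
    rewrite Dd size_Mmonic ?monicXsubC // size_XsubC addn2.
have X0 : 'X - r%:P != 0 :> {poly K} by rewrite polyXsubC_eq0.
have cancelX P P' : ('X - r%:P) *: P = ('X - r%:P) *: P' -> P = P'.
  by rewrite -!mul_polyC => /mulfI -> //; rewrite polyC_eq0.
have : map_poly (horner_eval r) P1 * map_poly (horner_eval r) P2 = 0.
  rewrite -rmorphM -E /= map_polyZ /= {1}/horner_eval Dd hornerM hornerXsubC.
  by rewrite subrr mulr0 scale0r.
move/eqP; rewrite mulf_eq0 => /orP[] /eqP/vanish[P' EP].
  have [|d [P1' [P2' [d0' E1 E2]]]] := IHn delta' P' P2 sd' d'0.
    by apply: cancelX; rewrite scalerA mulrC -Dd E EP scalerAl.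
  by exists (('X - r%:P) * d), P1', P2'; rewrite mulf_neq0 // EP E1 scalerA.
apply: (IHn delta' P1 P' sd' d'0).
by apply: cancelX; rewrite scalerA mulrC -Dd E EP scalerAr.
Qed.

Section Evaluation.
Variables (F : fieldType) (iota : {rmorphism K
  -> F}) (sigma : {rmorphism F -> F}).
Hypothesis sigC : forall c, sigma (iota c) = iota c.

Definition ev (y : F) : {poly K} -> F := horner_eval y \o map_poly iota.
HB.instance Definition _ y :=
  GRing.RMorphism.copy (ev y) (horner_eval y \o map_poly iota).

Lemma ev_polyC y c : ev y c%:P = iota c.
Proof. by rewrite /ev /= map_polyC /horner_eval hornerC. Qed.

Lemma iterm_ev i y p : iterm sigma i (ev y p) = ev (iterm sigma i y) p.
Proof.
rewrite /ev /= /horner_eval -horner_map /= -map_poly_comp; congr _.[_].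
apply: eq_map_poly => c /=; rewrite /iterm.
by elim: i => //= i ->; rewrite sigC.
Qed.

Lemma ev_sepp A B y :
  map_poly (ev y) (sepp A B) = map_poly iota A - (ev y B)%:P.
Proof.
rewrite rmorphB /= map_polyC /= -map_poly_comp; congr (_ - _).
by apply: eq_map_poly => c /=; rewrite ev_polyC.
Qed.

Variables (y : F) (b : nat).
Hypothesis trans_y : forall p, p != 0 -> (map_poly iota p).[y] != 0.
Hypothesis orb_y : forall i, (iter i sigma y == y) = (b %| i)%N.

Lemma ev_inj : injective (ev y).
Proof.
apply: raddf_inj => p E; apply: contraTeq isT => /trans_y.
by rewrite -[X in X != 0]/(ev y p) E eqxx.
Qed.

Lemma iterm_orbit i j : iterm sigma i y = iterm sigma j y -> i = j %[mod b].
Proof.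
wlog le_ij : i j / (i <= j)%N.
  by move=> W E; case/orP: (leq_total i j) => [/W->|/W->].
rewrite /iterm -(subnKC le_ij) iterD => /esym E.
have inj_iter : injective (iter i sigma).
  exact: (fmorph_inj (iterm sigma i : {rmorphism F -> F})).
move/eqP: (inj_iter _ _ E); rewrite orb_y => /dvdnP[k ->].
by rewrite addnC modnMDl.
Qed.

(** Lueroth's theorem for the polynomials invariant under sigma^m.  H is the
    minimal polynomial of y over the field they generate: of all polynomials in
    K[Y][X] vanishing at the block y, sigma^m y, sigma^2m y, ... take one of
    least degree in X and make it monic by Gauss's lemma.  Its coefficients
    are invariant, and one that has the largest degree in Y is the generator:
    U(X) - U(Y) is a multiple of H of the same degree in Y. *)
Lemma invariant_generator B m (cs : seq {poly K}) :
    size B = b.+1 -> (0 < b)%N -> (0 < m)%N -> B \in cs ->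
    sigma (ev y B) = ev y B ->
    (forall c, c \in cs -> iterm sigma m (ev y c) = ev y c) ->
    (forall i, (forall c, c \in cs -> iterm sigma i (ev y c) = ev y c) ->
       (m %| i)%N) ->
  exists U : {poly K}, size U = (b %/ m).+1 /\
    forall c, iterm sigma m (ev y c) = ev y c ->
      exists c1, c = c1 \Po U.
Proof.
move=> sB b_gt0 m_gt0 Bcs sigB fix_cs m_min.
pose ev0 : {rmorphism {poly K} -> F} := ev y.
pose y_ k := iterm sigma (m * k) y.
have ev0_inj : injective ev0 by exact: ev_inj.
have iter_b : iterm sigma b y = y by apply/eqP; rewrite [_ == _]orb_y.
have m_b : (m %| b)%N by apply: m_min => c _; rewrite iterm_ev // iter_b.
pose e := (b %/ m)%N; have Db : (m * e = b)%N by rewrite mulnC divnK.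
have e_gt0 : (0 < e)%N by rewrite divn_gt0 // dvdn_leq.
pose rs := [seq y_ k | k <- seq.iota 0 e].
pose fixed c := iterm sigma m (ev0 c) = ev0 c.
have iterm_mulS k z : iterm sigma (m * k.+1) z
  = iterm sigma m (iterm sigma (m * k) z).
  by rewrite /iterm mulnS iterD.
have fixed_y_ c k : fixed c -> ev (y_ k) c = ev0 c.
  move=> fc; rewrite /y_ -iterm_ev //; elim: k => [|k IHk];
    first by rewrite muln0.
  by rewrite iterm_mulS IHk.
have Urs : uniq rs.
  rewrite map_inj_in_uniq ?iota_uniq // => i j;
    rewrite !mem_iota /= => lt_i lt_j.
  move/iterm_orbit; rewrite -Db -!muln_modr !modn_small // => /eqP.
  by rewrite eqn_pmul2l // => /eqP.
have szrs : size rs = e by rewrite size_map size_iota.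
pose vanish Q := all (root (map_poly ev0 Q)) rs.
have vanishP Q : reflect (forall k, (k < e)%N
  -> (map_poly ev0 Q).[y_ k] = 0) (vanish Q).
  apply: (iffP allP) => [V k lt_k|V z].
    by apply/eqP; apply: V; apply: map_f; rewrite mem_iota.
  by case/mapP => k; rewrite mem_iota => /= lt_k ->; apply/eqP/V.
have vanish_small Q : vanish Q -> (size Q <= e)%N -> Q = 0.
  move=> VQ sQ; apply/eqP; apply: contraT => Q0.
  have Q0' : map_poly ev0 Q != 0.
    by rewrite -size_poly_eq0 size_map_inj_poly ?rmorph0 ?size_poly_eq0.
  have := max_poly_roots Q0' VQ Urs.
  by rewrite size_map_inj_poly ?rmorph0 // szrs ltnNge sQ.
have evC c z : (map_poly ev0 (sepp c c)).[z] = (map_poly iota c).[z] - ev0 c.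
  by rewrite ev_sepp hornerD hornerN hornerC.
have vanish_sepp c : fixed c -> vanish (sepp c c).
  move=> fc; apply/vanishP => k _; rewrite evC.
  by rewrite -[_.[_]]/(ev (y_ k) c) fixed_y_ // subrr.
have sB1 : (1 < size B)%N by rewrite sB.
have sepB0 : sepp B B != 0 by rewrite -size_poly_eq0 size_sepp // sB.
(* Q : a polynomial of least degree vanishing on the block. *)
have exQ : exists n, `[< exists Q, [/\ Q != 0, vanish Q & size Q = n] >].
  by exists (size (sepp B B)); apply/asboolP; exists (sepp B B);
     split=> //; apply/vanish_sepp/fix_cs.
case: (ex_minnP exQ) => nQ /asboolP[Q [Q0 VQ sQ]] Qmin.
have dvdQ c : fixed c -> exists d q, d != 0 /\ d *: sepp c c = Q * q.
  move=> fc; exists (lead_coef Q ^+ Pdiv.Ring.rscalp (sepp c c) Q).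
  exists (Pdiv.Ring.rdivp (sepp c c) Q).
  split; first by rewrite expf_neq0 ?lead_coef_eq0.
  rewrite Pdiv.ComRing.rdivp_eq [Q * _]mulrC.
  set r := Pdiv.Ring.rmodp _ _; suff -> : r = 0 by rewrite addr0.
  apply/eqP; apply: contraT => r0.
  have : (size r < nQ)%N by rewrite -sQ Pdiv.Ring.ltn_rmodpN0.
  rewrite ltnNge Qmin //; apply/asboolP; exists r; split=> //.
  apply/vanishP => k lt_k; have := Pdiv.ComRing.rdivp_eq Q (sepp c c).
  move/(congr1 (fun P => (map_poly ev0 P).[y_ k])).
  rewrite map_polyZ hornerZ (vanishP _ (vanish_sepp _ fc)) // mulr0.
  by rewrite rmorphD rmorphM hornerD hornerM /= (vanishP _ VQ) // mulr0 add0r.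
have Q0' : map_poly ev0 Q != 0.
  by rewrite -size_poly_eq0 size_map_inj_poly ?rmorph0 ?size_poly_eq0.
have rootQ c z : fixed c -> root (map_poly ev0 Q) z
  -> (map_poly iota c).[z] = ev0 c.
  move=> fc /eqP rz; have [d [q [d0]]] := dvdQ c fc.
  move/(congr1 (fun P => (map_poly ev0 P).[z])).
  rewrite map_polyZ hornerZ rmorphM hornerM /= rz mul0r evC => /eqP.
  by rewrite mulf_eq0 raddf_eq0 // (negbTE d0) subr_eq0 => /eqP.
(* All the roots of B(X) - B(y) are conjugates of y. *)
have splitB : map_poly ev0 (sepp B B)
    = iota (lead_coef B) *: \prod_(k <- seq.iota 0 b) ('X - (iterm sigma k y)%:P).
  have sz : size (map_poly ev0 (sepp B B)) = b.+1.
    by rewrite size_map_inj_poly ?rmorph0 // size_sepp.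
  rewrite -(big_map (fun k => iterm sigma k y) xpredT (fun z => 'X - z%:P)).
  have -> : iota (lead_coef B) = lead_coef (map_poly ev0 (sepp B B)).
    by rewrite lead_coef_map_inj ?rmorph0 // lead_coef_sepp //= ev_polyC.
  apply: all_roots_prod_XsubC; first by rewrite sz size_map size_iota.
    apply/allP => _ /mapP[k _ ->];
      rewrite rootE evC -[_.[_]]/(ev (iterm sigma k y) B).
    by rewrite -iterm_ev // /iterm iter_fix // subrr.
  rewrite uniq_rootsE map_inj_in_uniq ?iota_uniq // => i j.
  rewrite !mem_iota /= => lt_i lt_j /iterm_orbit.
  by rewrite !modn_small.
have szQ : size Q = e.+1.
  apply/eqP; rewrite eqn_leq; apply/andP; split; last first.
    by rewrite ltnNge; apply: contra_neqN Q0; apply: vanish_small.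
  have [d [q [d0 E]]] := dvdQ B (fix_cs _ Bcs).
  have : map_poly ev0 Q %| map_poly ev0 (d *: sepp B B).
    by rewrite E rmorphM dvdp_mulr.
  rewrite map_polyZ splitB scalerA dvdpZr; last first.
    by rewrite mulf_neq0 ?fmorph_eq0 ?lead_coef_eq0 -?size_poly_eq0
      ?sB // raddf_eq0.
  case/dvdp_prod_XsubC => ms; set ks := mask ms _ => EQ.
  have := eqp_size EQ; rewrite size_map_inj_poly
    ?rmorph0 // size_prod_XsubC => ->.
  rewrite ltnS -[X in (_ <= X)%N](size_iota 0) -[X in (_ <= X)%N](size_map (muln m)).
  apply: uniq_leq_size => [|k ks_k]; first by rewrite /ks; apply: mask_uniq;
    exact: iota_uniq.
  have m_k : (m %| k)%N.
    apply: m_min => c cs_c; rewrite iterm_ev //; apply: rootQ;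
      first exact: fix_cs.
    rewrite (eqp_root EQ) -(big_map (fun k =>
      iterm sigma k y) xpredT (fun z => 'X - z%:P)).
    by rewrite root_prod_XsubC; apply: map_f ks_k.
  rewrite -(divnK m_k) mulnC; apply: map_f.
  rewrite mem_iota add0n ltn_divLR // mulnC Db.
  by have := mem_mask ks_k; rewrite mem_iota.
have [H [H_monic szH rootH]] : exists H : {poly {poly K}},
    [/\ H \is monic, size H = e.+1 & vanish H].
  have [d [q [d0 E]]] := dvdQ B (fix_cs _ Bcs).
  have [d1 [P1 [P2 [d10 EQ EB]]]] := gauss_factor d0 E.
  have : lead_coef P1 * lead_coef P2 = (lead_coef B)%:P.
    by rewrite -lead_coefM -EB lead_coef_sepp.
  have lB0 : lead_coef B != 0 by rewrite lead_coef_eq0 -size_poly_eq0 sB.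
  move=> EL; have : size (lead_coef P1 * lead_coef P2) == 1%N.
    by rewrite EL size_polyC lB0.
  rewrite size_mul_eq1 => /andP[/size_poly1P[h h0 Dh] _].
  have hK : h%:P * (h^-1)%:P = 1 :> {poly K} by rewrite -rmorphM mulfV.
  have hP0 : (h^-1)%:P != 0 :> {poly K} by rewrite polyC_eq0 invr_eq0.
  exists ((h^-1)%:P *: P1); split.
  - by rewrite monicE lead_coefZ Dh mulrC hK.
  - by rewrite size_scale // -szQ EQ size_scale.
  apply/vanishP => k lt_k; have := vanishP _ VQ k lt_k.
  rewrite EQ !map_polyZ !hornerZ => /eqP; rewrite mulf_eq0 raddf_eq0 //.
  by rewrite (negbTE d10) => /eqP ->; rewrite mulr0.
have mapH : map_poly ev0 H = \prod_(0 <= k < e) ('X - (y_ k)%:P).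
  rewrite /index_iota subn0 -(big_map y_ xpredT (fun z => 'X - z%:P)).
  rewrite (@all_roots_prod_XsubC _ (map_poly ev0 H) rs) //.
  - by rewrite (monicP (monic_map _ H_monic)) scale1r.
  - by rewrite size_map_inj_poly ?rmorph0 // szH szrs.
  by rewrite uniq_rootsE.
have fixH j : fixed H`_j.
  rewrite /fixed -coef_map -[LHS]coef_map mapH.
  set P := \prod_(_ <= _ < _) _; suff -> : map_poly (iterm sigma m) P = P by [].
  rewrite /P.
  rewrite rmorph_prod /= (eq_bigr (fun k => 'X - (y_ k.+1)%:P)); last first.
    by move=> k _; rewrite rmorphB /= map_polyX map_polyC /= /y_ iterm_mulS.
  have y_e : y_ e = y_ 0%N by rewrite /y_ Db iter_b muln0.
  rewrite -(prednK e_gt0) big_nat_recr // [RHS]big_nat_recl //= prednK // y_e.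
  exact: mulrC.
have szmapH : size (map_poly ev0 H)
  = e.+1 by rewrite size_map_inj_poly ?rmorph0.
have mul_of_H c : fixed c -> exists q, sepp c c = q * H.
  move=> fc; exists (Pdiv.Ring.rdivp (sepp c c) H).
  rewrite {1}(Pdiv.RingMonic.rdivp_eq H_monic (sepp c c)).
  set r := Pdiv.Ring.rmodp _ _; suff -> : r = 0 by rewrite addr0.
  apply: vanish_small; last first.
    by rewrite -ltnS -szH Pdiv.Ring.ltn_rmodpN0 // monic_neq0.
  apply/vanishP => k lt_k; have := Pdiv.RingMonic.rdivp_eq H_monic (sepp c c).
  move/(congr1 (fun P => (map_poly ev0 P).[y_ k])).
  rewrite (vanishP _ (vanish_sepp _ fc)) // rmorphD rmorphM hornerD hornerM /=.
  by rewrite (vanishP _ rootH) // mulr0 add0r.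
have sYH : (1 < sizeY H)%N.
  rewrite ltnNge; apply/negP => sYH.
  have /size1_polyC E : (size (swapXY H) <= 1)%N by rewrite -sizeYE.
  have EH : H = map_poly polyC (swapXY H)`_0 by rewrite -swapXY_polyC -E swapXYK.
  have := vanishP _ rootH 0%N e_gt0; rewrite EH -map_poly_comp.
  rewrite (eq_map_poly (fun c => ev_polyC y c)) /y_ muln0 /iterm /= => /eqP.
  apply/negP; apply: trans_y.
  by apply: contraNneq (monic_neq0 H_monic) => h0; rewrite EH h0 rmorph0.
have [j Uj] : exists j, size H`_j = sizeY H.
  have [|i Ei] := @eq_bigmax 'I_(size H) (fun i => size H`_i).
    by rewrite card_ord szH.
  by exists i; rewrite /sizeY Ei.
pose U := H`_j; have sU : (1 < size U)%N by rewrite Uj.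
have [G EG] := mul_of_H U (fixH j).
have sepU0 : sepp U U != 0 by rewrite -size_poly_eq0 size_sepp // -lt0n ltnW.
have [g0 g00 Dg] : exists2 g0, g0 != 0 & G = map_poly polyC g0.
  have G0 : G != 0 by apply: contraNneq sepU0 => G0; rewrite EG G0 mul0r.
  have := congr1 (fun P => size (swapXY P)) EG;
    rewrite swapXY_sepp size_polyN size_sepp //.
  rewrite rmorphM /= size_mul ?swapXY_eq0
    ?(monic_neq0 H_monic) // -!sizeYE Uj => sG;
    have {sG} /size1_polyC E : (size (swapXY G) <= 1)%N.
    rewrite -sizeYE; case: (sizeY H) sYH sG => // h _; rewrite addnS /= => Eh.
    by rewrite -(leq_add2r h) add1n -Eh.
  have DG : G = map_poly polyC (swapXY G)`_0 by rewrite -swapXY_polyC -E swapXYK.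
  by exists (swapXY G)`_0 => //; apply: contraNneq G0 => g00;
    rewrite DG g00 rmorph0.
have sg0 : size g0 = 1%N.
  apply/eqP; apply: contraT => /closed_rootP[r /eqP g0r].
  move/(congr1 (horner^~ r%:P)): EG.
  rewrite /= hornerM Dg horner_map g0r rmorph0 mul0r.
  rewrite hornerD hornerN hornerC horner_map /= => /eqP;
    rewrite subr_eq0 => /eqP EU.
  by move: sU; rewrite -EU ltnNge size_polyC_leq1.
have /eqP/size_poly1P[g g_0 {}Dg0] := sg0.
exists U; split.
  rewrite -(size_sepp U sU) EG size_mul ?(monic_neq0 H_monic) //; last first.
    by apply: contraNneq sepU0 => G0; rewrite EG G0 mul0r.
  by rewrite Dg size_map_polyC sg0 szH.
move=> c; have [n] := ubnP (size c); elim: n c => // n IHn c;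
  rewrite ltnS => sc fc.
have [c1|c1] := leqP (size c) 1.
  by exists c; rewrite [c]size1_polyC // comp_polyC.
have [q0 Eq] := mul_of_H c fc;
  pose q := (map_poly (horner_eval 0) q0) * (g^-1)%:P.
(* c(X) - c(Y) is a multiple of U(X) - U(Y); specialize Y to 0. *)
have Ec : c - c.[0]%:P = q * (U - U.[0]%:P).
  have ev_0 p : map_poly (horner_eval 0) (sepp p p) = p - (p.[0])%:P.
    rewrite rmorphB /= map_polyC /= -map_poly_comp map_poly_id // => z _ /=.
    by rewrite /horner_eval hornerC.
  have ev_G : map_poly (horner_eval 0) G = g%:P.
    by rewrite Dg Dg0 !map_polyC /= /horner_eval hornerC.
  rewrite -!ev_0 Eq EG !rmorphM /= ev_G /q.
  by rewrite mulrA -(mulrA _ _ g%:P) -polyCM mulVf // mulr1.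
move: q Ec => q Ec.
have sU0 : size (U - U.[0]%:P) = size U.
  by rewrite size_polyDl // size_polyN (leq_ltn_trans (size_polyC_leq1 _)).
have sc0 : size (c - c.[0]%:P) = size c.
  by rewrite size_polyDl // size_polyN (leq_ltn_trans (size_polyC_leq1 _)).
have U0 : U - U.[0]%:P != 0 by rewrite -size_poly_eq0 sU0 -lt0n ltnW.
have [||q1 Eq1] := IHn q.
- have qn0 : q != 0.
    by apply: contraTneq c1 => qn0; rewrite -sc0 Ec qn0 mul0r size_poly0.
  apply: leq_trans sc; rewrite -sc0 Ec.
  rewrite (size_mul qn0 U0) sU0; case: (size U) sU => [|[|u]] //= _.
  by rewrite !addnS /= ltnS leq_addr.
- have := congr1 ev0 Ec; rewrite rmorphM rmorphB [ev0 (U - _)]rmorphB /=.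
  rewrite !ev_polyC => E; have E' := congr1 (iterm sigma m) E.
  have itermC z : iterm sigma m (iota z) = iota z.
    by rewrite -(ev_polyC y) iterm_ev // !ev_polyC.
  rewrite rmorphM !rmorphB /= !itermC fc (fixH j : iterm sigma m (ev0 U)
    = _) E in E'.
  apply/esym; apply: (mulIf _ E'); rewrite -(ev_polyC y) -rmorphB.
  by rewrite (raddf_eq0 _ ev0_inj).
exists (q1 * ('X - U.[0]%:P) + c.[0]%:P).
by rewrite comp_polyD comp_polyM comp_polyB comp_polyX !comp_polyC -Eq1 -Ec subrK.
Qed.
End Evaluation.
End Separated.

(** * Reducible separated polynomials *)

Section Descent.
Variable K : numClosedFieldType.
Implicit Types (A B U V p : {poly K}) (f g : {poly {poly K}}).

(** Fried's descent.  If b does not divide a, then sigma^a fixes every root of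
    A(X) = t and moves the roots of B(Y) = t.  Over K(y) the factor f(X, y) is a
    product of linear factors X - x_i, up to a constant, hence its
    coefficients are fixed by sigma^a although y is not. *)
Lemma separated_descent A B a b f g :
    size A = a.+1 -> size B = b.+1 -> (0 < a)%N -> (0 < b)%N -> ~~ (b %| a)%N ->
    f * g = sepp A B ->
  exists U B1 f1 g1, [/\ (2 < size U)%N, B = B1 \Po U,
    f = map_poly (comp_poly U) f1, g = map_poly (comp_poly U) g1
    & f1 * g1 = sepp A B1].
Proof.
move=> sA sB a_gt0 b_gt0 nba Efg.
have [F [iota [sigma [t [x [y [sigC trans_y [sigt Ax By] orb_x orb_y]]]]]]] :=
  monodromy_at_infinity sA sB a_gt0 b_gt0.
have evB : ev iota y B = t by [].
have itermC i z : iterm sigma i (iota z) = iota z.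
  by rewrite /iterm; apply: iter_fix.
have sA1 : (1 < size A)%N by rewrite sA.
have A0 : lead_coef A != 0 by rewrite lead_coef_eq0 -size_poly_eq0 sA.
pose rs := [seq iterm sigma k x | k <- seq.iota 0 a].
have splitA : map_poly (ev iota y) (sepp A B)
    = iota (lead_coef A) *: \prod_(z <- rs) ('X - z%:P).
  have lA : lead_coef (map_poly (ev iota y) (sepp A B)) = iota (lead_coef A).
    rewrite lead_coef_map_eq lead_coef_sepp //= ev_polyC //.
    by rewrite fmorph_eq0.
  rewrite -lA; apply: all_roots_prod_XsubC.
  - rewrite size_map seq.size_iota size_map_inj_poly ?rmorph0 ?size_sepp //.
    exact: ev_inj.
  - apply/allP => _ /mapP[k _ ->];
    rewrite rootE ev_sepp evB hornerD hornerN hornerC.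
    rewrite -[_.[_]]/(ev iota (iterm sigma k x) A) -iterm_ev //.
    by rewrite -[ev iota x A]/(_.[_]) Ax /iterm iter_fix // subrr.
  rewrite uniq_rootsE map_inj_in_uniq ?seq.iota_uniq // => i j.
  rewrite !mem_iota /= => lt_i lt_j /(iterm_orbit orb_x).
  by rewrite !modn_small.
have fixA z : z \in rs -> iterm sigma a z = z.
  case/mapP => k _ ->; rewrite /iterm -iterD addnC iterD.
  by congr iter; apply/eqP; rewrite orb_x.
have fix_coef h h' i : h * h' = sepp A B ->
    iterm sigma a (ev iota y h`_i) = ev iota y h`_i.
  move=> E; rewrite -coef_map -[LHS]coef_map /=.
  suff -> : map_poly (iterm sigma a) (map_poly (ev iota y) h)
    = map_poly (ev iota y) h by [].
  have lead_h : exists2 z, z != 0 & lead_coef h = z%:P.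
    have : size (lead_coef h * lead_coef h') == 1%N.
      by rewrite -lead_coefM E lead_coef_sepp // size_polyC A0.
    by rewrite size_mul_eq1 => /andP[/size_poly1P[z z0 ->] _]; exists z.
  have [z z0 Dz] := lead_h.
  have lh : lead_coef (map_poly (ev iota y) h) = iota z.
    by rewrite lead_coef_map_eq Dz /= ev_polyC // fmorph_eq0.
  have lA0 : iota (lead_coef A) != 0 by rewrite fmorph_eq0.
  have : map_poly (ev iota y) h %| \prod_(z <- rs) ('X - z%:P).
    by rewrite -(dvdpZr _ _ lA0) -splitA -E rmorphM dvdp_mulr.
  case/dvdp_prod_XsubC => ms /eqp_eq.
  rewrite lead_coef_prod_XsubC scale1r lh => ->.
  rewrite map_polyZ /= itermC rmorph_prod /=; congr (_ *: _).
  rewrite big_seq [RHS]big_seq; apply: eq_bigr => r /mem_mask r_rs.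
  by rewrite rmorphB /= map_polyX map_polyC /= fixA.
pose cs : seq {poly K} := B :: ((f : seq {poly K}) ++ (g : seq {poly K})).
have cs_fix_a c : c \in cs -> iterm sigma a (ev iota y c) = ev iota y c.
  rewrite inE mem_cat => /orP[/eqP -> | /orP[] /(nthP 0)[i _ <-]].
  - by rewrite evB /iterm iter_fix.
  - exact: fix_coef Efg.
  by apply: (fix_coef _ f); rewrite mulrC.
have y_b : iterm sigma b y = y by apply/eqP; rewrite [_ == _]orb_y.
(* sigma^m generates the stabilizer of all the coefficients. *)
pose D i := (0 < i)%N && all (fun c =>
  iterm sigma i (ev iota y c) == ev iota y c) cs.
have exD : exists i, D i.
  exists b; rewrite /D b_gt0; apply/allP => c _; apply/eqP.
  by rewrite iterm_ev // y_b.
case: (ex_minnP exD) => m /andP[m_gt0 /allP Dm] m_min.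
have fix_m c : c \in cs -> iterm sigma m (ev iota y c) = ev iota y c.
  by move/Dm/eqP.
have m_dvd i : (forall c, c \in cs
  -> iterm sigma i (ev iota y c) = ev iota y c) ->
    (m %| i)%N.
  move=> fix_i; apply: contraT; rewrite /dvdn -lt0n => r_gt0.
  suff : D (i %% m)%N by move/m_min; rewrite leqNgt ltn_pmod.
  rewrite /D r_gt0; apply/allP => c cs_c; apply/eqP.
  rewrite -[RHS]fix_i // [in RHS](divn_eq i m) addnC /iterm iterD.
  congr iter; elim: (i %/ m)%N => // k IHk; rewrite mulSn iterD -IHk.
  exact/esym/fix_m.
have m_a : (m %| a)%N by exact: m_dvd.
have m_b : (m %| b)%N by apply: m_dvd => c _; rewrite iterm_ev // y_b.
have sigB : sigma (ev iota y B) = ev iota y B by rewrite evB.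
have [U [sU genU]] := invariant_generator sigC trans_y orb_y sB b_gt0 m_gt0
  (mem_head B _) sigB fix_m m_dvd.
have /choice[d d_spec] : forall c, exists c1, c \in cs -> c = c1 \Po U.
  move=> c; case: (boolP (c \in cs)) => [/fix_m/genU[c1 ->]|_];
    last by exists 0.
  by exists c1.
have sU2 : (2 < size U)%N.
  rewrite sU ltnS ltn_divRL // mul1n ltn_neqAle dvdn_leq // andbT.
  by apply: contraNneq nba => <-.
pose lift (h : {poly {poly K}}) := \poly_(i < size h) d h`_i.
have liftE (h : {poly {poly K}}) : {subset (h : seq {poly K}) <= cs}
  -> h = map_poly (comp_poly U) (lift h).
  move=> sub; apply/polyP => i; rewrite coef_map /= coef_poly.
  case: ltnP => [lt_i|le_i]; first by rewrite -d_spec // sub ?mem_nth.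
  by rewrite nth_default // comp_poly0.
have Ef : f = map_poly (comp_poly U) (lift f).
  by apply: liftE => c cf; rewrite inE mem_cat cf orbT.
have Eg : g = map_poly (comp_poly U) (lift g).
  by apply: liftE => c cg; rewrite inE mem_cat cg !orbT.
have EB : B = d B \Po U by rewrite -d_spec ?mem_head.
exists U, (d B), (lift f), (lift g); split=> //.
have compU_inj : injective (comp_poly U).
  by apply: raddf_inj => p /eqP; rewrite comp_poly_eq0 ?(ltnW sU2) // => /eqP.
apply: (map_inj_poly compU_inj); first exact: comp_poly0.
rewrite rmorphM /= -Ef -Eg Efg /sepp rmorphB /= map_polyC /= -EB -map_poly_comp.
by congr (_ - _); apply: eq_map_poly => z /=; rewrite comp_polyC.
Qed.
End Descent.

Section Splitting.
Variable K : numClosedFieldType.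
Implicit Types (A B U V : {poly K}) (f g : {poly {poly K}}).

Definition splits A B := exists f g,
  [/\ f \isn't a GRing.unit, g \isn't a GRing.unit & f * g = sepp A B].

Lemma splits_sym A B : splits A B -> splits B A.
Proof.
have swap_unit f : swapXY f \is a GRing.unit -> f \is a GRing.unit.
  move=> uf; rewrite -[f]swapXYK.
  exact: (rmorph_unit (@swapXY K : {rmorphism _ -> _}) uf).
case=> f [g [nf ng E]]; exists (- swapXY f), (swapXY g); split.
- by rewrite unitrN; apply: contra nf; apply: swap_unit.
- by apply: contra ng; apply: swap_unit.
by rewrite mulNr -rmorphM /= E swapXY_sepp opprK.
Qed.

Lemma reducible_splits A B : (1 < size A)%N -> reducible_pair A B -> splits A B.
Proof.
move=> sA red; apply: contrapT => nsplit; apply: red; split.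
- by rewrite -size_poly_eq0 -[_ - _]/(sepp A B) size_sepp // -lt0n ltnW.
- by rewrite -[_ - _]/(sepp A B) unit_polypoly size_sepp // gtn_eqF.
move=> f g E; apply: contrapT => /not_orP[nf ng]; apply: nsplit.
by exists f, g; split; [apply/negP|apply/negP|].
Qed.

Lemma degree_comp (P Q : {poly K}) (n : nat) : size (P \Po Q) = n.+1
  -> (0 < n)%N ->
  exists p q, [/\ size P = p.+1, size Q = q.+1, (0 < p)%N,
    (0 < q)%N & n = (p * q)%N].
Proof.
move=> sPQ n_gt0; have := size_comp_poly P Q; rewrite sPQ /= => E.
have : (0 < (size P).-1 * (size Q).-1)%N by rewrite -E.
rewrite muln_gt0 => /andP[p_gt0 q_gt0].
exists (size P).-1, (size Q).-1; split=> //; first by case: (size P) p_gt0.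
by case: (size Q) q_gt0.
Qed.

Lemma splits_descent A B a b :
    size A = a.+1 -> size B = b.+1 -> (0 < a)%N -> (0 < b)%N -> ~~ (b %| a)%N ->
    splits A B -> exists U B1,
  [/\ (2 < size U)%N, B = B1 \Po U & splits A B1].
Proof.
move=> sA sB a_gt0 b_gt0 nba [f [g [nf ng E]]].
have [U [B1 [f1 [g1 [sU EB Ef Eg E1]]]]] :=
  separated_descent sA sB a_gt0 b_gt0 nba E.
exists U, B1; split=> //; exists f1, g1; split=> //.
  by apply: contra nf => uf; rewrite Ef rmorph_unit.
by apply: contra ng => ug; rewrite Eg rmorph_unit.
Qed.

(** If deg A and deg B differ, one of them does not divide the other, and the
    descent strictly lowers one of the two degrees. *)
Lemma splits_equal_degree A B :
    (1 < size A)%N -> (1 < size B)%N -> splits A B ->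
  exists A1 B1 U V, [/\ A = A1 \Po U, B = B1 \Po V, size A1 = size B1,
    (1 < size A1)%N & splits A1 B1].
Proof.
have [n] := ubnP (size A + size B)%N; elim: n A B => // n IHn A B.
rewrite ltnS => sAB sA sB spl.
have [a sA1] : exists a, size A = a.+2 by case: (size A) sA => [|[|a]] // _;
  exists a.
have [b sB1] : exists b, size B = b.+2 by case: (size B) sB => [|[|b]] // _;
  exists b.
have [nba|ba] := boolP (~~ (b.+1 %| a.+1)%N).
  have [U [B1 [sU EB spl1]]] := splits_descent sA1 sB1 isT isT nba spl.
  have := sB1; rewrite {1}EB =>
    /degree_comp/(_ isT)[p [q [sp sq p_gt0 q_gt0 Epq]]].
  have [|||A2 [B2 [U2 [V2 [E1 E2 E3 E4 E5]]]]] := IHn A B1 _ _ _ spl1.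
  - apply: leq_trans sAB; rewrite ltn_add2l sB1 sp ltnS Epq.
    by rewrite -[X in (X < _)%N]muln1 ltn_pmul2l // -ltnS -sq.
  - by [].
  - by rewrite sp ltnS.
  by exists A2, B2, U2, (V2 \Po U); rewrite EB {1}E2 comp_polyA.
have [nab|ab] := boolP (~~ (a.+1 %| b.+1)%N).
  have [U [A1 [sU EA spl1]]] :=
    splits_descent sB1 sA1 isT isT nab (splits_sym spl).
  have := sA1; rewrite {1}EA =>
    /degree_comp/(_ isT)[p [q [sp sq p_gt0 q_gt0 Epq]]].
  have [|||A2 [B2 [U2 [V2 [E1 E2 E3 E4 E5]]]]] :=
    IHn A1 B _ _ _ (splits_sym spl1).
  - apply: leq_trans sAB; rewrite ltn_add2r sA1 sp ltnS Epq.
    by rewrite -[X in (X < _)%N]muln1 ltn_pmul2l // -ltnS -sq.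
  - by rewrite sp ltnS.
  - by [].
  by exists A2, B2, (U2 \Po U), V2; rewrite EA {1}E1 comp_polyA.
exists A, B, 'X, 'X; rewrite !comp_polyXr; split=> //; rewrite sA1 sB1;
  congr _.+1.
by apply/eqP; rewrite eqn_dvd; move: ab ba; rewrite !negbK => -> ->.
Qed.

(** A factor of degree 1 in X is, up to a unit, X - h(Y), and A(h(Y)) = B(Y).
    The factors of a reducible A(X) - B(Y) have positive degree in X. *)
Lemma splits_degree A B : (1 < size A)%N -> splits A B ->
  (2 < size A)%N /\ (size A = 3 -> exists h, B = A \Po h).
Proof.
move=> sA [f [g [nf ng E]]].
have A0 : lead_coef A != 0 by rewrite lead_coef_eq0 -size_poly_eq0 -lt0n ltnW.
have /andP[lf lg] : (size (lead_coef f) == 1%N) && (size (lead_coef g) == 1%N).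
  by rewrite -size_mul_eq1 -lead_coefM E lead_coef_sepp // size_polyC A0.
have f0 : f != 0 by apply: contraTneq lf => ->; rewrite lead_coef0 size_poly0.
have g0 : g != 0 by apply: contraTneq lg => ->; rewrite lead_coef0 size_poly0.
have sz (h : {poly {poly K}}) : h != 0 -> h \isn't a GRing.unit
  -> size (lead_coef h) == 1%N -> (1 < size h)%N.
  move=> h0 nh lh; rewrite ltnNge; apply: contra nh => sh.
  have sh1 : size h = 1%N by apply/eqP; rewrite eqn_leq sh lt0n size_poly_eq0.
  by rewrite unit_polypoly sh1 /=; move: lh; rewrite lead_coefE sh1.
have sf := sz f f0 nf lf; have sg := sz g g0 ng lg.
have sfg : size A = (size f + size g).-1 by rewrite -(size_sepp B sA) -E size_mul.
split; first by rewrite sfg; move: sf sg; clear;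
  move: (size f) (size g) => m n; lia.
move=> sA3; have sf2 : size f = 2.
  by move: sfg sf sg; rewrite sA3; clear; move: (size f) (size g) => m n; lia.
have [z z0 Dz] := size_poly1P _ lf.
have Dz' : f`_1 = z%:P by rewrite -Dz lead_coefE sf2.
exists (- (z^-1)%:P * f`_0); apply/esym/eqP; rewrite -subr_eq0.
have := congr1 (horner^~ (- (z^-1)%:P * f`_0)) E.
rewrite /= hornerM hornerD hornerN hornerC => <-.
have -> : f.[- (z^-1)%:P * f`_0] = 0.
  rewrite horner_coef sf2 big_ord_recl big_ord1 expr0 mulr1 /= Dz'.
  by rewrite expr1 mulrA mulrN -polyCM mulfV // mulN1r subrr.
by rewrite mul0r.
Qed.
End Splitting.

(** * Two polynomials of the same degree *)

Section PowerDifference.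
Variable K : numClosedFieldType.
Implicit Types (A B P D S T : {poly K}).

Lemma coefM_top (p q : {poly K}) i j : (size p <= i.+1)%N
  -> (size q <= j.+1)%N ->
  (p * q)`_(i + j) = p`_i * q`_j.
Proof.
move=> sp sq; rewrite coefM.
have lt_i : (i < (i + j).+1)%N by rewrite ltnS leq_addr.
rewrite (bigD1 (Ordinal lt_i)) //= addKn big1 ?addr0 // => k.
rewrite -val_eqE /= => ne_ki; have [lt_ki|gt_ki|E] := ltngtP k i.
- rewrite [q`_ _]nth_default ?mulr0 // (leq_trans sq) //.
  by rewrite -ltnS in lt_ki; rewrite ltn_subRL ltn_add2r.
- by rewrite [p`_ _]nth_default ?mul0r // (leq_trans sp).
by rewrite E eqxx in ne_ki.
Qed.

Lemma size_exp_top (p : {poly K}) M n : (size p <= M.+1)%N ->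
  (size (p ^+ n) <= (n * M).+1)%N.
Proof.
move=> sp; have [->|p0] := eqVneq p 0.
  by rewrite expr0n; case: n => [|n]; rewrite ?size_poly1 ?size_poly0.
apply: leq_trans (size_poly_exp_leq _ _) _; rewrite ltnS mulnC leq_mul2l.
by rewrite -ltnS prednK ?sp ?orbT // lt0n size_poly_eq0.
Qed.

Lemma coef_exp_top (p : {poly K}) M n : (size p <= M.+1)%N ->
  (p ^+ n)`_(n * M) = p`_M ^+ n.
Proof.
move=> sp; elim: n => [|n IHn]; first by rewrite !expr0 coefC.
by rewrite !exprS mulSn coefM_top ?size_exp_top // IHn.
Qed.

Lemma subrXX_scaled (a b c : K) P1 P2 n : b = a * c ^+ n.+1 ->
  a *: P1 ^+ n.+1 - b *: P2 ^+ n.+1 =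
    (P1 - c *: P2) * (a *: \sum_(i < n.+1) P1 ^+ (n - i) * (c *: P2) ^+ i).
Proof.
move=> ->; rewrite -scalerAr -subrXX scalerBr; congr (_ - _).
by rewrite exprZn scalerA.
Qed.

(** The (n+1)-st root of b / a is found as the quotient of two leading
    coefficients, or of two values at 0: this picks the right one of n + 1 roots. *)
Lemma ratio_exists (a b x y : K) n : a != 0 -> b != 0 ->
  a * x ^+ n.+1 = b * y ^+ n.+1 -> x != 0 \/ y != 0 ->
  exists c, [/\ c != 0, b = a * c ^+ n.+1, x = c * y & x != 0].
Proof.
move=> a0 b0 E xy.
have x0 : x != 0.
  case: xy => // y0; apply: contra_eq_neq E => ->.
  by rewrite expr0n mulr0 eq_sym mulf_neq0 ?expf_neq0.
have y0 : y != 0.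
  apply: contra_eq_neq E => ->.
  by rewrite expr0n mulr0 mulf_neq0 ?expf_neq0.
exists (x / y); split=> //; first by rewrite mulf_neq0 ?invr_eq0.
  by rewrite expr_div_n mulrA E mulfK // expf_neq0.
by rewrite divfK.
Qed.

Lemma sum_pow_eq (x : K) n : \sum_(i < n.+1) x ^+ (n - i) * x ^+ i
  = x ^+ n *+ n.+1.
Proof.
under eq_bigr => i _ do rewrite -exprD subnK -1?ltnS //.
by rewrite sumr_const card_ord.
Qed.

(** Comparison of two branches at 0: only the factor P1 - c P2 of
    P1^(n+1) - (c P2)^(n+1) can vanish there. *)
Lemma branch_at_zero (a b : K) P1 P2 n k S : a != 0 -> b != 0 -> (0 < k)%N ->
    P1.[0] != 0 \/ P2.[0] != 0 ->
    a *: P1 ^+ n.+1 - b *: P2 ^+ n.+1 = 'X^(2 * k) * S ->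
  exists c T, c != 0 /\ P1 - c *: P2 = 'X^(2 * k) * T.
Proof.
move=> a0 b0 k_gt0 P0 E.
have E0 : a * P1.[0] ^+ n.+1 = b * P2.[0] ^+ n.+1.
  move/(congr1 (horner^~ 0)): E; rewrite hornerD hornerN !hornerZ !horner_exp.
  rewrite hornerM hornerXn expr0n muln_eq0 /= gtn_eqF // mul0r => /eqP.
  by rewrite subr_eq0 => /eqP.
have [c [c0 Db Dx x0]] := ratio_exists a0 b0 E0 P0; exists c.
rewrite (subrXX_scaled _ _ Db) in E; set Q := a *: _ in E.
have Q0 : ~~ root Q 0.
  rewrite rootE hornerZ horner_sum mulf_neq0 //.
  under eq_bigr => i _ do rewrite hornerM !horner_exp hornerZ -Dx.
  by rewrite sum_pow_eq mulrn_eq0 negb_or /= expf_neq0.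
have cop : coprimep 'X^(2 * k) Q.
  by apply: coprimep_expl;
    rewrite coprimep_sym -['X]subr0 -polyC0 coprimep_XsubC.
have : 'X^(2 * k) %| P1 - c *: P2 by rewrite -(Gauss_dvdpl _ cop) E dvdp_mulr.
by case/dvdpP => T ->; exists T; rewrite mulrC.
Qed.

(** Comparison at infinity: the cofactor of P1 - c P2 has the largest possible
    degree nM, which bounds the degree of P1 - c P2. *)
Lemma branch_at_infinity (a b : K) P1 P2 n k S M : a != 0 -> b != 0
  -> (k < M)%N ->
    (size P1 <= M.+1)%N -> (size P2 <= M.+1)%N -> P1`_M != 0 \/ P2`_M != 0 ->
    (n = 0%N -> S = 0) -> (size S <= (n.-1 * M).+1)%N ->
    a *: P1 ^+ n.+1 - b *: P2 ^+ n.+1 = 'X^(2 * k) * S ->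
  exists c, c != 0 /\
    (P1 = c *: P2 \/ P1 - c *: P2 != 0 /\ (size (P1 - c *: P2)%R + M <= (2
      * k).+1)%N).
Proof.
move=> a0 b0 lt_kM s1 s2 PM S0 sS E.
have sE : S != 0 -> (size ('X^(2 * k) * S)%R <= (2 * k + n.-1 * M).+1)%N.
  by move=> nS0; rewrite size_monicM
    ?monicXn // size_polyXn /= -addnS leq_add2l.
have EM : a * P1`_M ^+ n.+1 = b * P2`_M ^+ n.+1.
  move/(congr1 (fun p : {poly K} => p`_(n.+1 * M))): E.
  rewrite coefB !coefZ !coef_exp_top // [RHS]nth_default.
    by move/eqP; rewrite subr_eq0 => /eqP.
  have [->|nS0] := eqVneq S 0; first by rewrite mulr0 size_poly0.
  apply: leq_trans (sE nS0) _; case: n S0 nS0 {sS sE} => [|n] S0 nS0.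
    by rewrite S0 ?eqxx in nS0.
  by move: lt_kM; rewrite /= !mulSn; move: (n * M)%N; clear; lia.
have [c [c0 Db Dx x0]] := ratio_exists a0 b0 EM PM; exists c; split=> //.
rewrite (subrXX_scaled _ _ Db) in E; set Q := a *: _ in E.
have sP i : (i < n.+1)%N
  -> (size (P1 ^+ (n - i) * (c *: P2) ^+ i)%R <= (n * M).+1)%N.
  move=> le_in; apply: leq_trans (size_polyMleq _ _) _.
  have h1 := size_exp_top (n - i) s1.
  have h2 : (size ((c *: P2) ^+ i) <= (i * M).+1)%N.
    by apply: size_exp_top; rewrite size_scale.
  have -> : (n * M = (n - i) * M + i * M)%N by rewrite -mulnDl subnK // -ltnS.
  by move: h1 h2; clear; lia.
have cQ : Q`_(n * M) != 0.
  rewrite coefZ mulf_neq0 // coef_sum.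
  rewrite (eq_bigr (fun i : 'I_n.+1 => P1`_M ^+ (n - i) * P1`_M ^+ i)).
    by rewrite sum_pow_eq mulrn_eq0 negb_or /= expf_neq0.
  move=> i _; have le_in : (i <= n)%N by rewrite -ltnS.
  have -> : (n * M = (n - i) * M + i * M)%N by rewrite -mulnDl subnK.
  rewrite coefM_top ?coef_exp_top ?size_exp_top ?size_scale //.
  by rewrite coefZ -Dx.
have [/eqP|D0] := eqVneq (P1 - c *: P2) 0; first by rewrite subr_eq0 => /eqP;
  left.
right; split=> //; have sQ : (n * M < size Q)%N.
  by rewrite ltnNge; apply: contra cQ => sQ; rewrite nth_default.
have Q0 : Q != 0 by rewrite -size_poly_eq0 -lt0n (leq_ltn_trans _ sQ).
have S_neq0 : S != 0.
  by apply: contraTneq (mulf_neq0 D0 Q0) => S_0; rewrite E S_0 mulr0 eqxx.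
have := sE S_neq0; rewrite -E size_mul //.
case: (posnP n) => [n0|n_gt0]; first by rewrite S0 ?eqxx // in S_neq0.
move: sQ; have {1}-> : (n * M = M + n.-1 * M)%N by rewrite -mulSn prednK.
move: (size _) (size _) (n.-1 * M)%N => d q r; clear; lia.
Qed.

End PowerDifference.

(** * Laurent polynomials *)

Local Notation "A @@ L" := (ev (@ratC _) L A) (at level 40).

Section EvComp.
Variables (K : closedFieldType) (F : fieldType) (iota : {rmorphism K -> F}).
Lemma ev_comp (A B : {poly K}) y : ev iota y (A \Po B)
  = ev iota (ev iota y B) A.
Proof. by rewrite /ev /= /horner_eval map_comp_poly horner_comp. Qed.
Lemma ev_X y : ev iota y 'X = y.
Proof. by rewrite /ev /= /horner_eval map_polyX hornerX. Qed.
Lemma evE (A : {poly K}) y n : (size A <= n)%N ->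
  ev iota y A = \sum_(i < n) iota A`_i * y ^+ i.
Proof.
move=> sA; rewrite /ev /= /horner_eval (@horner_coef_wide _ n)
  ?size_map_poly //.
by apply: eq_bigr => i _; rewrite coef_map.
Qed.
End EvComp.

Section Laurent.
Variable K : numClosedFieldType.
Implicit Types (A B P Q : {poly K}) (L : ratfun K).

Lemma rat_comp_polyl A L : nonconstant L -> rat_comp A%:F L = A @@ L.
Proof.
move=> nL; rewrite -[A%:F]divr1 -tofrac1 rat_compE ?oner_neq0 //.
by rewrite [rat_eval 1 L](rmorph1 (ev (@ratC K) L)) divr1.
Qed.

Lemma ev_rat_inj L : nonconstant L -> injective (ev (@ratC K) L).
Proof.
move=> nL; apply: raddf_inj => p /eqP.
by rewrite [_ == _](rat_eval_eq0 p nL) => /eqP.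
Qed.

Lemma ev_size_gt1 A L : nonconstant (A @@ L) -> (1 < size A)%N.
Proof.
move=> nAL; rewrite ltnNge; apply/negP => /size1_polyC E.
by apply: (nAL A`_0); rewrite E ev_polyC coefC.
Qed.

Lemma nonconstant_ev A L : (1 < size A)%N -> nonconstant L
  -> nonconstant (A @@ L).
Proof.
move=> sA nL c E; move: sA;
  suff -> : A = c%:P by rewrite ltnNge size_polyC_leq1.
by apply: (ev_rat_inj nL); rewrite E ev_polyC.
Qed.

Lemma nonconstant_poly A : nonconstant A%:F <-> (1 < size A)%N.
Proof.
split=> [nA|sA c /eqP].
  rewrite ltnNge; apply/negP => /size1_polyC E.
  by apply: (nA A`_0); rewrite /ratC /= -E.
by rewrite tofrac_eq => /eqP E; move: sA; rewrite E ltnNge size_polyC_leq1.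
Qed.

Definition lau P k : ratfun K := P%:F / ('X^k)%:F.

Lemma Xn_neq0 k : ('X^k)%:F != 0 :> ratfun K.
Proof. by rewrite tofrac_eq0 monic_neq0 ?monicXn. Qed.

Lemma Laurent_lau P k : Laurent (lau P k).
Proof.
move=> c c0; exists P, 'X^k; split=> //.
by rewrite hornerXn expf_neq0.
Qed.

(** In lowest terms, 0 is the only possible root of the denominator. *)
Lemma LaurentP L : Laurent L -> exists P k, L = lau P k.
Proof.
move=> Lau; pose n := \n_(repr L); pose d := \d_(repr L).
have d0 : d != 0 by exact: denom_ratioP.
have EL : L = n%:F / d%:F by exact: frac_numden.
have nd0 : (n != 0) || (d != 0) by rewrite d0 orbT.
pose P := n %/ gcdp n d; pose Q := d %/ gcdp n d.
have g0 : gcdp n d != 0 by rewrite gcdp_eq0 negb_and.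
have nP : n = P * gcdp n d by rewrite divpK ?dvdp_gcdl.
have dQ : d = Q * gcdp n d by rewrite divpK ?dvdp_gcdr.
have cop : coprimep P Q by rewrite coprimep_div_gcd.
have Q0 : Q != 0 by apply: contraNneq d0 => E; rewrite dQ E mul0r.
have {}EL : L = P%:F / Q%:F.
  rewrite EL nP [in X in _ / X]dQ !tofracM invfM mulrACA divff ?mulr1 //.
  by rewrite tofrac_eq0.
have rootQ c : root Q c -> c = 0.
  move=> rc; apply/eqP; apply: contraT => /Lau[p [q [E qc]]].
  have q0 : q != 0 by apply: contraNneq qc => ->; rewrite horner0.
  move/eqP: E; rewrite EL eqr_div ?tofrac_eq0 // -!tofracM tofrac_eq => /eqP.
  move/(congr1 (horner^~ c)); rewrite !hornerM (rootP rc) mulr0 => /eqP.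
  rewrite mulf_eq0 (negbTE qc) orbF => Pc.
  by have := coprimep_root cop Pc; rewrite (rootP rc) eqxx.
have [r Dr] := closed_field_poly_normal Q.
have Dq : Q = lead_coef Q *: 'X^(size r).
  have Er : r = nseq (size r) 0.
    apply/all_pred1P/allP => z rz; apply/eqP/rootQ.
    by rewrite Dr rootZ ?lead_coef_eq0 // root_prod_XsubC.
  by rewrite {1}Dr {1}Er big_nseq subr0 iter_mulr_1.
exists ((lead_coef Q)^-1 *: P), (size r); apply/eqP.
rewrite EL /lau eqr_div ?Xn_neq0 ?(tofrac_eq0 Q) // -!tofracM tofrac_eq {2}Dq.
by rewrite -scalerAl -scalerAr scalerA mulVf ?lead_coef_eq0 // scale1r.
Qed.

Lemma lau_shift P k j : lau (P * 'X^j) (k + j) = lau P k.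
Proof.
rewrite /lau exprD !tofracM invfM [_^-1 * _]mulrC mulrA mulfK ?Xn_neq0 //.
Qed.

Lemma lau_inj P Q k : lau P k = lau Q k -> P = Q.
Proof.
by move/(mulIf (invr_neq0 (Xn_neq0 k)))/eqP; rewrite tofrac_eq => /eqP.
Qed.

Lemma lauD P Q k : lau P k + lau Q k = lau (P + Q) k.
Proof. by rewrite /lau -mulrDl -tofracD. Qed.

Lemma lauZ c P k : ratC c * lau P k = lau (c *: P) k.
Proof. by rewrite /lau mulrA -tofracM mul_polyC. Qed.

Lemma lauC c k : ratC c = lau (c *: 'X^k) k.
Proof. by rewrite /lau -mul_polyC tofracM mulfK ?Xn_neq0. Qed.

Lemma lauX P j n : lau P j ^+ n = lau (P ^+ n) (j * n).
Proof. by rewrite /lau exprMn exprVn -!tofracXn exprM. Qed.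

Lemma ev_lau A P n k : (size A <= n.+1)%N ->
  A @@ lau P k = lau (\sum_(i < n.+1) A`_i *: (P ^+ i * 'X^(k
    * (n - i)))) (k * n).
Proof.
move=> sA; rewrite (evE _ _ sA) /lau rmorph_sum mulr_suml;
  apply: eq_bigr => i _.
rewrite -[P%:F / _]/(lau P k) -[RHS]/(lau _ _) -lauZ lauX; congr (_ * _).
by rewrite -(lau_shift (P ^+ i) (k * i) (k * (n - i))) -mulnDr subnKC // -ltnS.
Qed.

Lemma Laurent_ev A L : Laurent L -> Laurent (A @@ L).
Proof.
case/LaurentP => P [k ->]; rewrite (@ev_lau A P (size A)) //.
exact: Laurent_lau.
Qed.

(** The least common denominator is taken so that, if there is a pole at 0 at
    all, one of the numerators does not vanish there. *)
Lemma common_denominator L1 L2 : Laurent L1 -> Laurent L2 ->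
  exists P1 P2 k, [/\ L1 = lau P1 k, L2 = lau P2 k
    & (0 < k)%N -> P1.[0] != 0 \/ P2.[0] != 0].
Proof.
move=> /LaurentP[Q1 [k1 E1]] /LaurentP[Q2 [k2 E2]].
have ex : exists k, `[< exists P1 P2, L1 = lau P1 k /\ L2 = lau P2 k >].
  exists (k1 + k2)%N; apply/asboolP; exists (Q1 * 'X^k2), (Q2 * 'X^k1).
  by rewrite lau_shift [(k1 + k2)%N]addnC lau_shift.
case: (ex_minnP ex) => k /asboolP[P1 [P2 [{}E1 {}E2]]] kmin.
exists P1, P2, k; split=> // k_gt0; apply: contrapT => /not_orP[/negP];
  rewrite negbK.
move=> r1 /negP; rewrite negbK => r2.
have [R1 D1] := factor_theorem P1 0 r1; have [R2 D2] := factor_theorem P2 0 r2.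
have : (k <= k.-1)%N.
  apply: kmin; apply/asboolP; exists R1, R2.
  have cancelX R : lau (R * ('X - 0%:P)) k = lau R k.-1.
    by rewrite -(lau_shift R k.-1 1) addn1 prednK // expr1 subr0.
  by rewrite E1 E2 D1 D2 !cancelX.
by rewrite -ltnS prednK // ltnn.
Qed.

(** Once the term of degree n is removed, the leading term of the composite
    with P / X^k exceeds all others by a factor of order (P / X^k)^2; the
    comparison of the branches at 0 and at infinity rests on this gain. *)
Lemma center A n : size A = n.+2 -> exists alpha A',
  A \Po ('X - alpha%:P) = lead_coef A *: 'X^(n.+1) + A' /\ (size A' <= n)%N.
Proof.
move=> sA; set a := lead_coef A.
have a0 : a != 0 by rewrite lead_coef_eq0 -size_poly_eq0 sA.
have shift m alpha : exists E : {poly K}, (size E <= m)%N /\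
    ('X - alpha%:P) ^+ m.+1 = 'X^(m.+1) - (m.+1%:R * alpha) *: 'X^m + E.
  elim: m => [|m [E [sE IH]]].
    by exists 0; rewrite size_poly0 !expr1 expr0 addr0 mul1r alg_polyC.
  exists ((m.+1%:R * alpha ^+ 2) *: 'X^m + ('X - alpha%:P) * E); split.
    apply: leq_trans (size_polyD _ _) _; rewrite geq_max; apply/andP; split.
      by apply: leq_trans (size_scale_leq _ _) _; rewrite size_polyXn.
    by apply: leq_trans (size_polyMleq _ _) _; rewrite size_XsubC.
  rewrite exprS IH -!mul_polyC !exprS !polyCM -[m.+2%:R]natr1 polyCD polyC1;
    ring.
pose alpha := A`_n / (n.+1%:R * a); exists alpha.
exists ((A \Po ('X - alpha%:P)) - a *: 'X^(n.+1)); split;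
  first by rewrite [RHS]addrC subrK.
have na0 : n.+1%:R * a != 0 by rewrite mulf_neq0 ?pnatr_eq0.
have -> : A = a *: 'X^(n.+1) + A`_n *: 'X^n + take_poly n A.
  apply/polyP => i; rewrite !coefD !coefZ !coefXn coef_take_poly.
  have [lt_i|] := ltnP i n; first by rewrite !ltn_eqF ?mulr0 ?add0r // ltnW.
  rewrite leq_eqVlt => /orP[/eqP <-|].
    by rewrite eqxx ltn_eqF // mulr0 mulr1 add0r addr0.
  rewrite leq_eqVlt => /orP[/eqP <-|lt_i].
    by rewrite eqxx gtn_eqF // /a lead_coefE sA mulr1 mulr0 !addr0.
  by rewrite !gtn_eqF ?mulr0 ?addr0 // ?(ltnW lt_i) // nth_default // sA.
rewrite !comp_polyD !comp_polyZ !comp_Xn_poly.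
have [E [sE ->]] := shift n alpha.
have -> : a *: ('X^(n.+1) - (n.+1%:R
  * alpha) *: 'X^n + E) + A`_n *: ('X - alpha%:P) ^+ n
    + (take_poly n A \Po ('X - alpha%:P)) - a *: 'X^(n.+1)
    = a *: E + A`_n *: (('X - alpha%:P) ^+ n - 'X^n) + (take_poly n A \Po ('X - alpha%:P)).
  have Da : A`_n = a * (n.+1%:R
    * alpha) by rewrite /alpha mulrCA mulrA mulrC divfK.
  rewrite Da -!mul_polyC !polyCM; ring.
apply: leq_trans (size_polyD _ _) _; rewrite geq_max; apply/andP; split.
  apply: leq_trans (size_polyD _ _) _; rewrite geq_max; apply/andP; split.
    exact: leq_trans (size_scale_leq _ _) sE.
  apply: leq_trans (size_scale_leq _ _) _.
  case: (n) => [|m]; first by rewrite !expr0 subrr size_poly0.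
  have [E' [sE' ->]] := shift m alpha;
    rewrite addrAC [_ - _ - _]addrAC subrr sub0r.
  apply: leq_trans (size_polyD _ _) _;
    rewrite geq_max size_polyN (leqW sE') andbT.
  by apply: leq_trans (size_scale_leq _ _) _; rewrite size_polyXn.
by rewrite size_comp_poly2 ?size_XsubC // size_take_poly.
Qed.
End Laurent.

Section TwoPoles.
Variable K : numClosedFieldType.
Implicit Types (A B P Q : {poly K}) (L : ratfun K).

(** The terms of degree < n of a centered polynomial of degree n + 1, with X^(2k)
    factored out of their common numerator. *)
Lemma tail_lau A P n k : (size A <= n)%N
  -> exists S : {poly K}, [/\ n = 0%N -> S = 0,
    forall M, (k <= M)%N -> (size P <= M.+1)%N -> (size S <= (n.-1 * M).+1)%N
    & A @@ lau P k = lau ('X^(2 * k) * S) (k * n.+1)].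
Proof.
case: n => [|n] sA.
  exists 0; split=> // [M _ _|]; first by rewrite size_poly0.
  have -> : A = 0 by apply/eqP; rewrite -size_poly_leq0.
  by rewrite rmorph0 mulr0 /lau tofrac0 mul0r.
exists (\sum_(i < n.+1) A`_i *: (P ^+ i * 'X^(k * (n - i))));
  split=> // [M le_kM sP|].
  apply: leq_trans (size_sum _ _ _) _; apply/bigmax_leqP => i _.
  apply: leq_trans (size_scale_leq _ _) _.
  apply: leq_trans (size_polyMleq _ _) _; rewrite size_polyXn addnS /=.
  have le_in : (i <= n)%N by rewrite -ltnS.
  have -> : ((n.+1).-1 * M
    = i * M + M * (n - i))%N by rewrite /= [(M * _)%N]mulnC -mulnDl subnKC.
  by rewrite -addSn leq_add ?size_exp_top // leq_mul2r le_kM orbT.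
rewrite (ev_lau _ _ sA) -(lau_shift _ _ (2 * k)) mulrC; congr (lau (_ * _) _).
  by lia.
Qed.

(** The conditions at 0 and at infinity on P1 - c P2 and P1 - c' P2 are so
    strong together that these polynomials can only be a constant and a
    multiple of X^(2k), unless one of them vanishes. *)
Lemma equal_powers_pair n (a b : K) A B P1 P2 k : a != 0 -> b != 0 ->
    (size A <= n)%N -> (size B <= n)%N ->
    ((0 < k)%N -> P1.[0] != 0 \/ P2.[0] != 0) -> nonconstant (lau P1 k) ->
    (a *: 'X^(n.+1) + A) @@ lau P1 k = (b *: 'X^(n.+1) + B) @@ lau P2 k ->
  (exists c, P1 = c *: P2) \/
  exists c c' kap lam, [/\ (0 < k)%N, [/\ c != 0, c' != 0, kap != 0 & lam != 0],
    c != c', P1 - c *: P2 = kap%:P & P1 - c' *: P2 = lam *: 'X^(2 * k)].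
Proof.
move=> a0 b0 sA sB P0 nL1 E.
have [S1 [S10 sS1 E1]] := tail_lau P1 k sA;
  have [S2 [S20 sS2 E2]] := tail_lau P2 k sB.
have {E} E : a *: P1 ^+ n.+1 - b *: P2 ^+ n.+1 = 'X^(2 * k) * (S2 - S1).
  have evXn c P : (c *: 'X^(n.+1)) @@ lau P k = lau (c *: P ^+ n.+1) (k * n.+1).
    by rewrite -mul_polyC rmorphM rmorphXn /= ev_polyC ev_X lauX lauZ.
  move: E; rewrite !rmorphD /= !evXn E1 E2 !lauD => /lau_inj E.
  rewrite (canRL (addrK _) E) mulrBr.
  by rewrite addrAC [X in X - _]addrAC subrr add0r.
set S := S2 - S1 in E.
have S0 : n = 0%N -> S = 0 by move=> n0; rewrite /S S10 ?S20 ?subrr.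
have [D0|/eqP nP] := eqVneq P1 (0 *: P2); first by left; exists 0.
pose M := (maxn (size P1) (size P2)).-1.
have P1_neq0 : P1 != 0 by apply/eqP; rewrite scale0r in nP.
have M1 : (0 < maxn (size P1) (size P2))%N by rewrite leq_max lt0n size_poly_eq0 P1_neq0.
have s1 : (size P1 <= M.+1)%N by rewrite prednK // leq_maxl.
have s2 : (size P2 <= M.+1)%N by rewrite prednK // leq_maxr.
have PM : P1`_M != 0 \/ P2`_M != 0.
  rewrite /M; have [le21|lt12] := leqP (size P2) (size P1).
    by left; rewrite -lead_coefE lead_coef_eq0.
  right; rewrite -lead_coefE lead_coef_eq0 -size_poly_eq0 -lt0n.
  exact: leq_ltn_trans lt12.
have sS : (k < M)%N -> (size S <= (n.-1 * M).+1)%N.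
  move=> lt_kM; apply: leq_trans (size_polyD _ _) _; rewrite size_polyN geq_max.
  by rewrite sS1 ?sS2 // ltnW.
have sD (c : K) : (size (P1 - c *: P2)%R <= M.+1)%N.
  apply: leq_trans (size_polyD _ _) _; rewrite size_polyN geq_max s1 /=.
  exact: leq_trans (size_scale_leq _ _) s2.
have infty : (k < M)%N -> exists c, c != 0 /\
    (P1 = c *: P2 \/ P1 - c *: P2 != 0 /\ (size (P1 - c *: P2)%R + M <= (2
      * k).+1)%N).
  by move=> lt_kM; apply: (branch_at_infinity a0 b0 lt_kM s1 s2 PM S0 (sS lt_kM) E).
case: (posnP k) => [k0|k_gt0].
  have infty_M : (0 < M)%N.
    rewrite lt0n; apply: contra_notN (nL1 P1`_0) => /eqP M0; rewrite M0 in s1.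
    by rewrite k0 /lau expr0 tofrac1 divr1 {1}[P1]size1_polyC.
  have [|c [c0 [Ec|[D0]]]] := infty; [by rewrite k0|by left; exists c|].
  rewrite -size_poly_eq0 -lt0n in D0; rewrite k0 muln0.
  by have := infty_M; move: D0; move: (size _) => d; clear; lia.
have [c' [T [c'0 ET]]] := branch_at_zero a0 b0 k_gt0 (P0 k_gt0) E.
have [T0|T0] := eqVneq T 0.
  by left; exists c'; apply/eqP; rewrite -subr_eq0 ET T0 mulr0.
have sT : size (P1 - c' *: P2) = (2 * k + size T)%N.
  by rewrite ET size_monicM ?monicXn // size_polyXn.
have T_gt0 : (0 < size T)%N by rewrite lt0n size_poly_eq0.
have le2k : (2 * k <= M)%N.
  by have := sD c'; rewrite sT; move: T_gt0; clear; lia.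
have [|c [c0 [Ec|[D0 sDM]]]] := infty; first by move: le2k k_gt0; clear; lia.
  by left; exists c.
right; have D_gt0 : (0 < size (P1 - c *: P2)%R)%N by rewrite lt0n size_poly_eq0.
have sD1 : size (P1 - c *: P2) == 1%N.
  by move: sDM D_gt0 le2k; move: (size _) => d; clear; lia.
have sT1 : size T == 1%N.
  by have := sD c'; rewrite sT; move: sDM D_gt0 T_gt0;
    move: (size _) (size _) => d d'; clear; lia.
have [kap kap0 Dk] := size_poly1P _ sD1;
  have [lam lam0 Dl] := size_poly1P _ sT1.
exists c, c', kap, lam; split=> //; last by rewrite ET Dl mulrC mul_polyC.
apply: contraTneq sD1 => ->; rewrite sT; move: k_gt0 T_gt0; clear; lia.
Qed.

Lemma joukE (z : K) k : joukowski z k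
  = ratC (2%:R^-1) * (ratC z * ('X : {poly K})%:F ^+ k + (ratC z
  * ('X : {poly K})%:F ^+ k)^-1).
Proof. by rewrite /joukowski -mul_polyC tofracM tofracXn. Qed.

Lemma jouk_of_two_terms (p q : K) k : p != 0 -> q != 0 ->
  lau (p *: 'X^(2 * k) + q%:P) k
    = ratC (2%:R * p / sqrtC (p / q)) * joukowski (sqrtC (p / q)) k.
Proof.
move=> p0 q0; have z0 : sqrtC (p / q) != 0 by rewrite sqrtC_eq0 mulf_neq0
  ?invr_eq0.
set z := sqrtC _ in z0 *; have zz : z ^+ 2 = p / q by rewrite sqrtCK.
have rat0 c : c != 0 -> ratC c != 0 by rewrite fmorph_eq0.
have X0 : 'X%:F ^+ k != 0 :> ratfun K by rewrite -tofracXn Xn_neq0.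
rewrite joukE /lau tofracD -mul_polyC tofracM !tofracXn mulnC exprM.
rewrite mulrA -rmorphM mulrDr mulrDl; congr (_ + _).
  rewrite mulrA -rmorphM expr2 !mulrA mulfK //; congr (ratC _ * _).
  by field; rewrite ?z0.
rewrite invfM mulrA -fmorphV -rmorphM; congr (ratC _ * _).
have -> : 2%:R * p / z / 2%:R / z = p / z ^+ 2 by field; rewrite ?z0.
by rewrite zz invfM invrK mulrA divff ?mul1r.
Qed.

(** Two Laurent polynomials L1, L2 with A o L1 = B o L2 and deg A = deg B have
    poles of the same orders; near each pole they are proportional up to small
    terms, and either the two constants of proportionality agree, or L1 and L2
    are combinations of 1, z^k and z^-k. *)
Lemma two_pole_pair A B n L1 L2 : size A = n.+2 -> size B = n.+2 ->
    Laurent L1 -> Laurent L2 -> nonconstant L1 -> A @@ L1 = B @@ L2 ->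
  (exists c c0, L1 = ratC c * L2 + ratC c0) \/
  exists k l1 z1 c1 l2 z2 c2, [/\ (0 < k)%N,
    [/\ l1 != 0, z1 != 0, l2 != 0 & z2 != 0], z1 ^+ 2 != z2 ^+ 2,
    L1 = ratC l1 * joukowski z1 k + ratC c1 &
    L2 = ratC l2 * joukowski z2 k + ratC c2].
Proof.
move=> sA sB Lau1 Lau2 nL1 E.
have [Q1 [Q2 [k [E1 E2 Q0]]]] := common_denominator Lau1 Lau2.
have [al [A' [EA sA']]] := center sA; have [be [B' [EB sB']]] := center sB.
have A0 : lead_coef A != 0 by rewrite lead_coef_eq0 -size_poly_eq0 sA.
have B0 : lead_coef B != 0 by rewrite lead_coef_eq0 -size_poly_eq0 sB.
pose P1 := Q1 + al *: 'X^k; pose P2 := Q2 + be *: 'X^k.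
have EP1 : lau P1 k = L1 + ratC al by rewrite (lauC al k) E1 lauD.
have EP2 : lau P2 k = L2 + ratC be by rewrite (lauC be k) E2 lauD.
have shift C c C' L : C \Po ('X - c%:P) = C'
  -> C @@ L = C' @@ (L + ratC c) :> ratfun K.
  by move=> <-; rewrite ev_comp rmorphB /= ev_X ev_polyC addrK.
rewrite (shift _ _ _ L1 EA) (shift _ _ _ L2 EB) -EP1 -EP2 in E.
have P0 : (0 < k)%N -> P1.[0] != 0 \/ P2.[0] != 0.
  move=> k_gt0; have := Q0 k_gt0; rewrite !hornerD !hornerZ !hornerXn.
  by rewrite expr0n gtn_eqF // !mulr0 !addr0.
have nP1 : nonconstant (lau P1 k).
  move=> c Ec; apply: (nL1 (c - al)); rewrite rmorphB /= -Ec EP1.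
  by rewrite addrK.
clearbody P1 P2.
have [[c Dc]|] := equal_powers_pair A0 B0 sA' sB' P0 nP1 E.
  left; exists c, (c * be - al); apply: (addIr (ratC al)).
  rewrite -EP1 Dc -lauZ EP2 mulrDr rmorphB rmorphM /= -addrA subrK.
  by [].
case=> c [c' [kap [lam [k_gt0 [c0 c'0 kap0 lam0] ncc' D1 D2]]]].
have dc0 : c' - c != 0 by rewrite subr_eq0 eq_sym.
have DP2 : P2 = (- lam / (c' - c)) *: 'X^(2 * k) + (kap / (c' - c))%:P.
  apply: (scalerI dc0); rewrite -!mul_polyC mulrDr !mulrA -!polyCM.
  rewrite ![(c' - c) * (_ / _)]mulrC !divfK //.
  rewrite -mul_polyC in D1; rewrite -!mul_polyC in D2.
  rewrite polyCN mulNr -D1 -D2 polyCB; ring.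
have DP1 : P1 = (- c * lam / (c' - c)) *: 'X^(2 * k) + (c' * kap / (c' - c))%:P.
  apply: (scalerI dc0); rewrite -!mul_polyC mulrDr !mulrA -!polyCM.
  rewrite ![(c' - c) * (_ / _)]mulrC !divfK //.
  rewrite -mul_polyC in D1; rewrite -!mul_polyC in D2.
  rewrite !polyCM polyCN -[_ * lam%:P * _]mulrA -D1 -D2 polyCB; ring.
right; exists k.
have p10 : - c * lam / (c' - c) != 0 by rewrite !mulf_neq0 ?invr_eq0 ?oppr_eq0.
have q10 : c' * kap / (c' - c) != 0 by rewrite !mulf_neq0 ?invr_eq0.
have p20 : - lam / (c' - c) != 0 by rewrite !mulf_neq0 ?invr_eq0 ?oppr_eq0.
have q20 : kap / (c' - c) != 0 by rewrite !mulf_neq0 ?invr_eq0.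
have L1E := jouk_of_two_terms k p10 q10;
  have L2E := jouk_of_two_terms k p20 q20.
rewrite -DP1 EP1 in L1E; rewrite -DP2 EP2 in L2E.
have half0 p q : p != 0 -> q != 0
  -> 2%:R * p / sqrtC (p / q) != 0 /\ sqrtC (p / q) != 0 :> K.
  by move=> p0 q0; rewrite !mulf_neq0 ?invr_eq0 ?sqrtC_eq0 ?mulf_neq0
    ?invr_eq0 ?pnatr_eq0.
have [l10 z10] := half0 _ _ p10 q10; have [l20 z20] := half0 _ _ p20 q20.
exists (2%:R * (- c * lam / (c' - c)) / sqrtC (- c * lam / (c' - c) / (c'
  * kap / (c' - c)))).
exists (sqrtC (- c * lam / (c' - c) / (c' * kap / (c' - c)))), (- al).
exists (2%:R * (- lam / (c' - c)) / sqrtC (- lam / (c' - c) / (kap / (c' - c)))).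
exists (sqrtC (- lam / (c' - c) / (kap / (c' - c)))), (- be).
split=> //; [|by rewrite -L1E rmorphN addrK|by rewrite -L2E rmorphN addrK].
rewrite !sqrtCK.
have -> : - c * lam / (c' - c) / (c' * kap / (c' - c))
  = (c / c') * (- lam / kap).
  by field; rewrite dc0 c'0 kap0.
have -> : - lam / (c' - c) / (kap / (c' - c)) = - lam / kap.
  by field; rewrite dc0 kap0.
rewrite -[X in _ != X]mul1r (inj_eq (mulIf _)); last first.
  by rewrite mulf_neq0 ?invr_eq0 ?oppr_eq0.
by rewrite -subr_eq0 -[1](divff c'0) -mulrBl mulf_neq0 ?invr_eq0 // subr_eq0.
Qed.

End TwoPoles.

(** * Chebyshev polynomials and z + 1/z *)

(** The formula 2 cos x cos y = cos (x + y) + cos (x - y), u and uv being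
    exp(ix) and exp(iy), and t = 2. *)
Lemma jouk_addition (F : fieldType) (t u v : F) : t != 0 -> u != 0 -> v != 0 ->
  t * (t^-1 * (u + u^-1) * (t^-1 * (u * v + (u * v)^-1))) - t^-1 * (v + v^-1)
  = t^-1 * (u * (u * v) + (u * (u * v))^-1).
Proof. by move=> t0 u0 v0; field; rewrite t0 u0 v0. Qed.

Section Chebyshev.
Variable K : numClosedFieldType.
Implicit Types (A B P Q : {poly K}) (L : ratfun K).

Lemma chebyshevSS n : chebyshev n.+2 =
  2%:R *: ('X * chebyshev n.+1) - chebyshev n :> {poly K}.
Proof. by []. Qed.

Lemma cheb_ind (P : nat -> Prop) : P 0%N -> P 1%N ->
  (forall n, P n -> P n.+1 -> P n.+2) -> forall n, P n.
Proof.
move=> P0 P1 PS n; suff: P n /\ P n.+1 by case.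
by elim: n => [|n [IH1 IH2]]; split=> //; apply: PS.
Qed.

Lemma two_neq0 : 2%:R != 0 :> K. Proof. by rewrite pnatr_eq0. Qed.

Lemma size_chebyshev n : size (chebyshev n : {poly K}) = n.+1.
Proof.
elim/cheb_ind: n => [||n IH1 IH2]; rewrite ?size_poly1 ?size_polyX //.
rewrite chebyshevSS; have s : size (2%:R *: ('X
  * chebyshev n.+1) : {poly K}) = n.+3.
  by rewrite size_scale ?two_neq0 // mulrC size_mulX ?IH2 // -size_poly_eq0 IH2.
by rewrite size_polyDl s // size_polyN IH1.
Qed.

Lemma chebyshev_jouk n (z : K) k : z != 0 ->
  chebyshev n @@ joukowski z k = joukowski (z ^+ n) (k * n).
Proof.
move=> z0; rewrite !joukE rmorphXn exprM -exprMn; set u := ratC z * _.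
have u0 : u != 0 by rewrite mulf_neq0 ?fmorph_eq0 // -tofracXn Xn_neq0.
have t0 : ratC (2%:R : K) != 0 by rewrite fmorph_eq0 two_neq0.
have h : ratC (2%:R^-1 : K) = (ratC 2%:R)^-1 by rewrite fmorphV.
rewrite h; elim/cheb_ind: n => [||n IH1 IH2].
- rewrite rmorph1 expr0 invr1 -(rmorph1 (@ratC K)) -rmorphD -mulr2n.
  by rewrite mulVf.
- by rewrite ev_X expr1.
rewrite chebyshevSS rmorphB -mul_polyC !rmorphM /= ev_polyC ev_X IH1 IH2 !exprS.
exact: jouk_addition t0 u0 (expf_neq0 n u0).
Qed.

Lemma jouk_lau (z : K) k : z != 0 ->
  joukowski z k = lau ((2%:R^-1 * z) *: 'X^(2 * k) + (2%:R^-1 * z^-1)%:P) k.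
Proof.
move=> z0; have X0 : ('X : {poly K})%:F ^+ k != 0 by rewrite -tofracXn Xn_neq0.
rewrite joukE /lau tofracD -mul_polyC tofracM !tofracXn mulnC exprM.
rewrite mulrDl mulrDr; congr (_ + _).
  by rewrite expr2 [in RHS]mulrA (mulfK X0) mulrA -rmorphM.
by rewrite invfM mulrA -fmorphV -rmorphM.
Qed.

Lemma Laurent_jouk (z : K) k : z != 0 -> Laurent (joukowski z k).
Proof. by move=> z0; rewrite jouk_lau //; apply: Laurent_lau. Qed.

Lemma nonconstant_jouk (z : K) k : z != 0 -> (0 < k)%N
  -> nonconstant (joukowski z k).
Proof.
move=> z0 k_gt0 c; rewrite jouk_lau // (lauC c k) => /lau_inj.
move/(congr1 (fun p : {poly K} => p`_(2 * k))).
rewrite coefD !coefZ !coefXn coefC eqxx mulr1 muln_eq0 /= [k == 0%N]gtn_eqF //.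
rewrite gtn_eqF ?mulr0 ?addr0;
  last by rewrite mul2n -addnn -[X in (X < _)%N]addn0 ltn_add2l.
by move/eqP; rewrite mulf_eq0 (negbTE z0) orbF invr_eq0 (negbTE two_neq0).
Qed.

Lemma joukN (z : K) k : joukowski (- z) k = - joukowski z k.
Proof. by rewrite !joukE rmorphN mulNr invrN -opprD mulrN. Qed.

Lemma chebyshev_basis n A : (size A <= n)%N ->
  exists alpha : nat -> K, A = \sum_(i < n) alpha i *: chebyshev i.
Proof.
elim: n A => [|n IHn] A sA.
  by exists (fun=> 0); rewrite big_ord0; apply/eqP; rewrite -size_poly_leq0.
pose t := lead_coef (chebyshev n : {poly K}).
have t0 : t != 0 by rewrite lead_coef_eq0 -size_poly_eq0 size_chebyshev.
have [|alpha Ea] := IHn (A - (A`_n / t) *: chebyshev n).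
  apply/leq_sizeP => i; rewrite leq_eqVlt => /orP[/eqP <-|lt_ni].
    rewrite coefB coefZ /t lead_coefE size_chebyshev /= divfK ?subrr //.
    by have := t0; rewrite /t lead_coefE size_chebyshev.
  by rewrite nth_default // (leq_trans _ lt_ni) //
    (leq_trans (size_polyD _ _)) //
             size_polyN geq_max sA (leq_trans (size_scale_leq _ _)) //
               size_chebyshev.
exists (fun i => if (i < n)%N then alpha i else A`_n / t).
rewrite big_ord_recr /= ltnn -[LHS](subrK ((A`_n / t) *: chebyshev n)) Ea;
  congr (_ + _).
by apply: eq_bigr => i _; rewrite ltn_ord.
Qed.

Lemma ev_chebyshev_sum n (alpha : nat -> K) (z : K) k : z != 0 ->
  (\sum_(i < n) alpha i *: chebyshev i) @@ joukowski z k
  = \sum_(i < n) ratC (alpha i) * joukowski (z ^+ i) (k * i).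
Proof.
move=> z0; rewrite rmorph_sum; apply: eq_bigr => i _.
by rewrite -mul_polyC rmorphM /= ev_polyC chebyshev_jouk.
Qed.

(** The two sides are read off at the exponents k i and - k i. *)
Lemma jouk_coef n (alpha beta : nat -> K) (z x : K) k : z != 0 -> x != 0
  -> (0 < k)%N ->
  \sum_(i < n) ratC (alpha i) * joukowski (z ^+ i) (k * i)
    = \sum_(i < n) ratC (beta i) * joukowski (x ^+ i) (k * i) ->
  forall i, (i < n)%N -> alpha i * z ^+ i = beta i * x ^+ i
                      /\ alpha i * z ^- i = beta i * x ^- i.
Proof.
move=> z0 x0 k_gt0.
pose S (a : nat -> K) (y : K) := \sum_(i < n) a i *:
  (y ^+ i *: 'X^(k * (n + i)) + y ^- i *: 'X^(k * (n - i)) : {poly K}).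
have ES (a : nat -> K) (y : K) : y != 0
  -> \sum_(i < n) ratC (a i) * joukowski (y ^+ i) (k * i)
    = ratC (2%:R^-1) * lau (S a y) (k * n).
  move=> y0; rewrite lauZ /S scaler_sumr /lau rmorph_sum mulr_suml.
  apply: eq_bigr => i _; have le_in : (i <= n)%N by rewrite ltnW.
  rewrite -[RHS]/(lau _ _) scalerA (mulrC _ (a i)) -scalerA -lauZ;
    congr (_ * _).
  rewrite jouk_lau ?expf_neq0 // -(lau_shift _ (k * i) (k
    * (n - i))) -mulnDr subnKC //.
  congr (lau _ _); rewrite scalerDr !scalerA mulrDl -!mul_polyC -mulrA;
    congr (_ * _ + _ * _).
  by rewrite -exprD; congr (_ ^+ _); nia.
rewrite !ES // => /(mulfI (_ : ratC 2%:R^-1 != 0)).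
rewrite fmorph_eq0 invr_eq0 two_neq0 => /(_ isT)/lau_inj E.
have coefS (a : nat -> K) (y : K) i : (i < n)%N ->
    (S a y)`_(k * (n + i)) = a i * (y ^+ i + (i == 0%N)%:R)
    /\ (S a y)`_(k * (n - i)) = a i * (y ^- i + (i == 0%N)%:R).
  move=> lt_in.
  have E1 j : (j < n)%N -> ((n + i == n - j) = (i == 0) && (j == 0))%N.
    by move=> lt_jn; clear -lt_in lt_jn; lia.
  have E2 j : (j < n)%N -> ((n - i == n + j) = (i == 0) && (j == 0))%N.
    by move=> lt_jn; clear -lt_in lt_jn; lia.
  have E3 j : (j < n)%N -> ((n - i == n - j) = (i == j))%N.
    by move=> lt_jn; clear -lt_in lt_jn; lia.
  split; rewrite coef_sum (bigD1 (Ordinal lt_in)) //= big1 ?addr0 => [|j].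
  - rewrite coefZ coefD !coefZ !coefXn !eqn_pmul2l // eqxx E1 // andbb mulr1.
    by case: (i) => [|i'] /=; rewrite ?expr0 ?invr1 ?mulr1 ?mulr0.
  - rewrite -val_eqE /= => ne_ji;
    rewrite coefZ coefD !coefZ !coefXn !eqn_pmul2l // eqn_add2l E1 //.
    rewrite eq_sym (negbTE ne_ji) mulr0 add0r;
      case: andP => [[/eqP i0 /eqP j0]|].
      by rewrite i0 j0 in ne_ji.
    by rewrite !mulr0.
  - rewrite coefZ coefD !coefZ !coefXn !eqn_pmul2l // eqxx E2 //
    andbb mulr1 addrC.
    by case: (i) => [|i'] /=; rewrite ?expr0 ?invr1 ?mulr1 ?mulr0.
  - rewrite -val_eqE /= => ne_ji;
    rewrite coefZ coefD !coefZ !coefXn !eqn_pmul2l // E3 // E2 //.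
    rewrite [i == j]eq_sym (negbTE ne_ji) mulr0 addr0;
      case: andP => [[/eqP i0 /eqP j0]|].
      by rewrite i0 j0 in ne_ji.
    by rewrite !mulr0.
have [n0|n_gt0] := posnP n.
  by move=> i; rewrite n0.
move=> i lt_in; have [c1 c2] := coefS alpha z i lt_in;
  have [d1 d2] := coefS beta x i lt_in.
rewrite E in c1 c2; rewrite d1 in c1; rewrite d2 in c2.
have [i0|i_gt0] := posnP i.
  rewrite i0 !expr0 invr1 !mulr1; suff -> : alpha 0%N = beta 0%N by [].
  rewrite i0 eqxx !expr0 -mulr2n in c1; apply/esym/(mulIf _ c1).
  exact: two_neq0.
by rewrite gtn_eqF // !addr0 in c1 c2; split; apply/esym.
Qed.
End Chebyshev.

Section ChebyshevPairs.
Variable K : numClosedFieldType.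
Implicit Types (A B P Q : {poly K}) (L : ratfun K).

(** Composition is checked on z + 1/z, where T_n raises z to the power n. *)
Lemma chebyshev_comp m n : chebyshev m \Po chebyshev n
  = chebyshev (n * m) :> {poly K}.
Proof.
apply: (ev_rat_inj (nonconstant_jouk (oner_neq0 K) (ltnSn 0))).
by rewrite ev_comp !chebyshev_jouk ?oner_neq0 // ?expf_neq0
  ?oner_neq0 // !expr1n !mul1n.
Qed.

Lemma chebyshev_sum_comp m N (alpha : nat -> K) : (0 < m)%N ->
  (forall i, (i < N)%N -> alpha i != 0 -> (m %| i)%N) ->
  exists P, \sum_(i < N) alpha i *: chebyshev i = P \Po chebyshev m.
Proof.
move=> m_gt0; elim: N => [|N IHN] supp.
  by exists 0; rewrite big_ord0 comp_poly0.
have [|P EP] := IHN; first by move=> i lt_iN; apply: supp; apply: ltnW.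
rewrite big_ord_recr /= EP; have [->|aN] := eqVneq (alpha N) 0.
  by exists P; rewrite scale0r addr0.
have /dvdnP[j ->] := supp N (ltnSn N) aN.
exists (P + alpha (j * m)%N *: chebyshev j).
by rewrite comp_polyD comp_polyZ chebyshev_comp mulnC.
Qed.

(** Comparing Chebyshev expansions: in A only the T_i with (z/x)^(2i) = 1 can
    occur, so A is a polynomial in T_m, where m is the order of (z/x)^2. *)
Lemma jouk_pair A B (z x : K) k : (1 < size A)%N -> z != 0 -> x != 0
  -> (0 < k)%N ->
    z ^+ 2 != x ^+ 2 -> A @@ joukowski z k = B @@ joukowski x k ->
  exists m (s : K) P, [/\ (1 < m)%N, s ^+ 2 = 1, z ^+ m = s * x ^+ m,
    A = P \Po chebyshev m & B = P \Po (s *: chebyshev m)].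
Proof.
move=> sA z0 x0 k_gt0 nzx E; pose N := maxn (size A) (size B).
have [alpha EA] := chebyshev_basis (leq_maxl (size A) (size B)).
have [beta EB] := chebyshev_basis (leq_maxr (size A) (size B)).
rewrite -/N in EA EB; have N_gt0 : (0 < N)%N by rewrite leq_max (ltnW sA).
have coefE : forall i, (i < N)%N -> alpha i * z ^+ i = beta i * x ^+ i
                      /\ alpha i * z ^- i = beta i * x ^- i.
  by apply: (jouk_coef z0 x0 k_gt0); rewrite -!ev_chebyshev_sum // -EA -EB.
pose th := (z / x) ^+ 2.
have th1 : th != 1.
  by rewrite /th expr_div_n -subr_eq0 -(divff (expf_neq0 2 x0)) -mulrBl
    mulf_neq0 ?invr_eq0 ?expf_neq0 // subr_eq0.
have supp i : (i < N)%N -> alpha i != 0 -> th ^+ i = 1.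
  move=> /coefE[E1 E2] ai; have zi := expf_neq0 i z0; have xi := expf_neq0 i x0.
  have Eb : beta i = alpha i * z ^+ i / x ^+ i by rewrite E1 mulfK.
  rewrite Eb in E2; apply: (mulfI ai); apply: (mulIf (invr_neq0 zi)).
  rewrite mulr1 E2 /th -exprM mulnC exprM expr_div_n.
  by move: (z ^+ i) (x ^+ i) zi xi => u v u0 v0; field; rewrite u0 v0.
have [i [i_gt0 lt_iN ai]] : exists i, [/\ (0 < i)%N, (i < N)%N & alpha i != 0].
  apply: contrapT => none; move: sA;
    suff -> : A = (alpha 0%N)%:P by rewrite ltnNge size_polyC_leq1.
  rewrite EA; case: (N) N_gt0 none => // N' _ none;
    rewrite big_ord_recl big1 ?addr0 //= ?alg_polyC // => i _.
  have [->|ai] := eqVneq (alpha (bump 0 i)) 0; first by rewrite scale0r.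
  by case: none; exists (bump 0 i); split=> //; rewrite /bump /= ltnS.
have [m m_prim m_i] := prim_order_exists i_gt0 (supp i lt_iN ai).
have m_gt0 := prim_order_gt0 m_prim.
have m_neq1 : m != 1%N.
  by apply: contraNneq th1 => m1; have := prim_expr_order m_prim;
    rewrite m1 expr1 => ->.
have [|P EP] := @chebyshev_sum_comp m N alpha m_gt0.
  by move=> j lt_j aj; rewrite (prim_order_dvd m_prim) supp.
have zm : z ^+ m = (z / x) ^+ m
  * x ^+ m by rewrite expr_div_n divfK // expf_neq0.
have s2 : (z / x) ^+ m ^+ 2
  = 1 by rewrite -exprM mulnC exprM (prim_expr_order m_prim).
exists m, ((z / x) ^+ m), P; split=> //;
  [by rewrite ltn_neqAle eq_sym m_neq1|by rewrite EA|].
apply: (ev_rat_inj (nonconstant_jouk x0 k_gt0)); rewrite -E EA EP !ev_comp.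
congr (P @@ _); rewrite -mul_polyC rmorphM /= ev_polyC !chebyshev_jouk //.
rewrite zm; move/eqP: s2; rewrite sqrf_eq1 => /orP[] /eqP ->.
  by rewrite rmorph1 !mul1r.
by rewrite rmorphN rmorph1 !mulN1r joukN.
Qed.

End ChebyshevPairs.

Section Decomposition.
Variable K : numClosedFieldType.
Implicit Types (A B P Q : {poly K}) (L : ratfun K).

(** The pole at 0 has order k a on one side and N on the other. *)
Lemma jouk_pole_order A a P k (g : K) N : size A = a.+1 -> (0 < N)%N
  -> g != 0 ->
  ((0 < k)%N -> P.[0] != 0) -> A @@ lau P k = joukowski g N -> N = (k * a)%N.
Proof.
move=> sA N_gt0 g0 P0; rewrite (ev_lau _ _ (eq_leq sA)) jouk_lau //.
set H := \sum_(i < a.+1) _; set J := _ + _ => E.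
have J0 : J.[0] != 0.
  rewrite hornerD hornerZ hornerXn hornerC expr0n muln_eq0 /= gtn_eqF //.
  by rewrite mulr0 add0r mulf_neq0 ?invr_eq0 ?two_neq0.
have {}E : H * 'X^N = J * 'X^(k * a).
  by apply: (@lau_inj _ _ _ (k * a + N)); rewrite lau_shift addnC lau_shift.
have X0 n : 'X^n != 0 :> {poly K} by rewrite monic_neq0 ?monicXn.
have [lt_N|gt_N|//] := ltngtP N (k * a).
  have k_gt0 : (0 < k)%N by case: (k) lt_N.
  have H0 : H.[0] != 0.
    rewrite horner_sum big_ord_recr /= big1 ?add0r => [|i _].
      rewrite subnn muln0 expr0 mulr1 hornerZ horner_exp mulf_neq0
        ?expf_neq0 ?P0 //.
      by have := lead_coef_eq0 A;
        rewrite lead_coefE sA /= -size_poly_eq0 sA => ->.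
    rewrite hornerZ hornerM hornerXn expr0n muln_eq0 subn_eq0 leqNgt ltn_ord.
    by rewrite [k == 0%N]gtn_eqF // !mulr0.
  case/negP: H0; move: E;
    rewrite -(subnK (ltnW lt_N)) exprD mulrA => /(mulIf (X0 N)) ->.
  by rewrite hornerM hornerXn expr0n gtn_eqF ?subn_gt0 // mulr0.
case/negP: J0; move: E;
  rewrite -(subnK (ltnW gt_N)) exprD mulrA => /(mulIf (X0 _)) <-.
by rewrite hornerM hornerXn expr0n gtn_eqF ?subn_gt0 // mulr0.
Qed.

(** The left factors of z^N + 1/z^N are Chebyshev polynomials.  If r^a = g, then
    T_a composed with (r z^k + 1/(r z^k)) / 2 is the given function, so A and T_a
    form a pair of polynomials of equal degree, which determines L up to
    scaling; a comparison of coefficients then determines A. *)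
Lemma jouk_decomposition A a L (g : K) N : size A = a.+1 -> (0 < a)%N
  -> (0 < N)%N ->
    g != 0 -> Laurent L -> nonconstant L -> A @@ L = joukowski g N ->
  exists s (lam z c e : K), [/\ (a * s)%N = N, lam != 0 /\ z != 0, e ^+ 2 = 1,
    A \Po (lam *: 'X + c%:P) = e *: chebyshev a
    & L = ratC lam * joukowski z s + ratC c].
Proof.
move=> sA a_gt0 N_gt0 g0 Lau nL E.
have [P [P' [k [EP EP' P0]]]] := common_denominator Lau Lau.
have PP' : P' = P by apply: (@lau_inj _ _ _ k); rewrite -EP -EP'.
have {}P0 : (0 < k)%N -> P.[0] != 0 by move/P0; rewrite PP'; case.
have DN : N = (k * a)%N by apply: (jouk_pole_order sA N_gt0 g0 P0); rewrite -EP.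
have k_gt0 : (0 < k)%N by move: N_gt0; rewrite DN muln_gt0 => /andP[].
pose r := a.-root g; have ra : r ^+ a = g by rewrite rootCK.
have r0 : r != 0 by apply: contraNneq g0 => r0; rewrite -ra r0 expr0n gtn_eqF.
have E' : A @@ L = chebyshev a @@ joukowski r k by rewrite chebyshev_jouk // ra -DN.
have [lam [z [s [c [s_gt0 lam0 z0 EL]]]]] : exists (lam z : K) s c,
    [/\ (0 < s)%N, lam != 0, z != 0 & L = ratC lam * joukowski z s + ratC c].
  have sA' : size A = a.-1.+2 by rewrite prednK.
  have sT : size (chebyshev a : {poly K})
    = a.-1.+2 by rewrite prednK // size_chebyshev.
  have := two_pole_pair sA' sT Lau (Laurent_jouk k r0) nL E'.
  case=> [[lam [c EL]]|[s [lam [z [c [l2 [z2 [c2 [s_gt0 [l0 z0 _ _] _ EL _]]]]]]]]].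
    exists lam, r, k, c; split=> //.
    by apply/eqP => l0; apply: (nL c); rewrite EL l0 rmorph0 mul0r add0r.
  by exists lam, z, s, c.
pose A' := A \Po (lam *: 'X + c%:P).
have sA' : size A' = a.+1.
  by rewrite size_comp_poly2 ?sA // size_polyDl size_scale
    ?size_polyX // ltnS size_polyC_leq1.
have EA' : A' @@ joukowski z s = joukowski g N.
  by rewrite ev_comp rmorphD /= -mul_polyC rmorphM /= !ev_polyC ev_X -EL.
have DN' : N = (s * a)%N.
  rewrite jouk_lau // in EA'; apply: (jouk_pole_order sA' N_gt0 g0 _ EA') => _.
  rewrite hornerD hornerZ hornerXn hornerC expr0n muln_eq0 /= gtn_eqF //.
  by rewrite mulr0 add0r mulf_neq0 ?invr_eq0 ?two_neq0.
have [alpha Ea] := chebyshev_basis (eq_leq sA').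
have cmp : forall i, (i < a.+1)%N -> alpha i * z ^+ i = (i == a)%:R * r ^+ i
   /\ alpha i * z ^- i = (i == a)%:R * r ^- i.
  apply: (jouk_coef z0 r0 s_gt0); rewrite -ev_chebyshev_sum // -Ea EA' DN'.
  rewrite big_ord_recr /= eqxx rmorph1 mul1r ra big1 ?add0r // => i _.
  by rewrite ltn_eqF // rmorph0 mul0r.
have alpha0 i : (i < a)%N -> alpha i = 0.
  move=> lt_ia; have [E1 _] := cmp i (ltnW lt_ia);
    apply: (mulIf (expf_neq0 i z0)).
  by rewrite E1 ltn_eqF // !mul0r.
have [E1 E2] := cmp a (ltnSn a); rewrite eqxx !mul1r in E1 E2.
exists s, lam, z, c, (alpha a); split=> //; first by rewrite mulnC.
  have : (alpha a * z ^+ a) * (alpha a * z ^- a) = 1.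
    by rewrite E1 E2 divff // expf_neq0.
  by rewrite mulrACA divff ?expf_neq0 // mulr1.
rewrite -/A' Ea big_ord_recr /= big1 ?add0r // => i _.
by rewrite alpha0 // scale0r.
Qed.
End Decomposition.

(** * Decompositions without a common left factor *)

Section Primitive.
Variable K : numClosedFieldType.
Implicit Types (A B C P Q U V W : {poly K}) (L : ratfun K).

(** The condition left when a common left factor of A and B of the largest
    degree has been removed: by Lueroth's theorem, it says that C(A o L1) is the
    intersection of C(L1) and C(L2). *)
Definition primitive A B L1 L2 := forall Q A' B',
  A = Q \Po A' -> B = Q \Po B' -> A' @@ L1 = B' @@ L2 -> (size Q <= 2)%N.

Lemma primitive_exists A B L1 L2 : (1 < size A)%N -> A @@ L1 = B @@ L2 ->
  exists Q At Bt, [/\ A = Q \Po At, B = Q \Po Bt, At @@ L1 = Bt @@ L2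
    & primitive At Bt L1 L2].
Proof.
have [n] := ubnP (size A); elim: n A B => // n IHn A B;
  rewrite ltnS => sAn sA E.
have [prim|nprim] := pselect (primitive A B L1 L2).
  by exists 'X, A, B; rewrite !comp_polyX.
have [Q [A' [B' [EA EB E' sQ]]]] : exists Q A' B',
    [/\ A = Q \Po A', B = Q \Po B', A' @@ L1 = B' @@ L2 & (2 < size Q)%N].
  apply: contrapT => none; apply: nprim => Q A' B' EA EB E'.
  by rewrite leqNgt; apply/negP => sQ; apply: none; exists Q, A', B'.
have [a sA1] : exists a, size A = a.+2 by case: (size A) sA => [|[|a]] // _;
  exists a.
have := sA1; rewrite {1}EA =>
  /degree_comp/(_ isT)[p [q [sp sq p_gt0 q_gt0 Epq]]].
have [||Q' [At [Bt [E1 E2 E3 E4]]]] := IHn A' B' _ _ E'.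
- apply: leq_trans sAn;
  rewrite sq sA1 Epq ltnS -[X in (X < _)%N]mul1n ltn_pmul2r //.
  by rewrite -ltnS -sp.
- by rewrite sq ltnS.
by exists (Q \Po Q'), At, Bt; rewrite EA EB {1}E1 {1}E2 !comp_polyA.
Qed.

Lemma ev_poly P Q : P @@ Q%:F = (P \Po Q)%:F.
Proof. by rewrite /comp_poly -horner_map -map_poly_comp. Qed.

Lemma ev_affine (lam c : K) L : (lam *: 'X + c%:P) @@ L = ratC lam * L + ratC c.
Proof. by rewrite rmorphD /= -mul_polyC rmorphM /= !ev_polyC ev_X. Qed.

Definition affine_inv (lam c : K) : {poly K} := lam^-1 *: ('X - c%:P).

Lemma affineK (lam c : K) : lam != 0
  -> (lam *: 'X + c%:P) \Po affine_inv lam c = 'X.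
Proof.
move=> l0; rewrite comp_polyD comp_polyZ comp_polyX comp_polyC /affine_inv.
by rewrite scalerA mulfV // scale1r subrK.
Qed.

Lemma affine_invK (lam c : K) : lam != 0
  -> affine_inv lam c \Po (lam *: 'X + c%:P) = 'X.
Proof.
move=> l0; rewrite comp_polyZ comp_polyB comp_polyX comp_polyC addrK.
by rewrite scalerA mulVf // scale1r.
Qed.

Lemma size_affine (lam c : K) : lam != 0 -> size (lam *: 'X + c%:P) = 2.
Proof.
by move=> l0; rewrite size_polyDl size_scale
  ?size_polyX // ltnS size_polyC_leq1.
Qed.

Lemma size_affine_inv (lam c : K) : lam != 0 -> size (affine_inv lam c) = 2.
Proof. by move=> l0; rewrite size_scale ?invr_eq0 // size_XsubC. Qed.

Lemma equiv_decomp_affine A C (lam c : K) L : lam != 0 -> (1 < size C)%N ->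
  A \Po (lam *: 'X + c%:P) = C -> nonconstant L ->
  equiv_decomp A%:F (ratC lam * L + ratC c) C%:F L.
Proof.
move=> l0 sC EC nL; exists (affine_inv lam c)%:F, (lam *: 'X + c%:P)%:F; split.
- exists (affine_inv lam c), 1; split; rewrite ?oner_neq0 ?coprimep1 //.
    by rewrite tofrac1 divr1.
  by rewrite size_affine_inv // size_poly1.
- by rewrite !rat_comp_poly ?size_affine
  ?size_affine_inv // affineK // affine_invK.
- by rewrite rat_comp_poly
  ?size_affine_inv // -EC -comp_polyA affineK // comp_polyXr.
by rewrite rat_comp_polyl // ev_affine.
Qed.

Lemma rat_comp_lau P k W : (1 < size W)%N ->
  rat_comp (lau P k) W%:F = (P \Po W)%:F / (W ^+ k)%:F.
Proof.
move=> sW; rewrite rat_compE ?monic_neq0 ?monicXn //;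
  last exact/nonconstant_poly.
by rewrite -[rat_eval P _]/(P @@ _) -[rat_eval 'X^k _]/(_ @@ _) !ev_poly comp_Xn_poly.
Qed.

Lemma rat_comp_X L : rat_comp L ('X)%:F = L.
Proof.
rewrite [in RHS](frac_numden L) {1}(frac_numden L) rat_compE.
- by rewrite -[rat_eval _ _]/(_ @@ _) -[X in _ / X]/(_ @@ _) !ev_poly !comp_polyXr.
- by apply/nonconstant_poly; rewrite size_polyX.
exact: denom_ratioP.
Qed.

Lemma jouk_inj (x y : K) k : x != 0 -> y != 0 -> (0 < k)%N ->
  joukowski x k = joukowski y k -> x = y.
Proof.
move=> x0 y0 k_gt0; rewrite !jouk_lau // =>
  /lau_inj/(congr1 (fun p : {poly K} => p`_(2 * k))).
rewrite !coefD !coefZ !coefXn !coefC eqxx !mulr1 muln_eq0 /= gtn_eqF // !addr0.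
by apply: mulfI; rewrite invr_eq0 two_neq0.
Qed.

Lemma rat_comp_affine_jouk (lam d eps om : K) k w : eps != 0 -> om != 0
  -> (0 < w)%N ->
  rat_comp (ratC lam * joukowski eps k + ratC d) (om *: 'X^w)%:F
  = ratC lam * joukowski (eps * om ^+ k) (w * k) + ratC d.
Proof.
move=> eps0 om0 w_gt0; have sW : (1 < size (om *: 'X^w : {poly K}))%N.
  by rewrite size_scale // size_polyXn ltnS.
have E c j : c != 0 -> ratC lam * joukowski c j + ratC d = lau (lam *:
    ((2%:R^-1 * c) *: 'X^(2 * j) + (2%:R^-1 * c^-1)%:P) + d *: 'X^j) j.
  by move=> c0; rewrite jouk_lau // lauZ (lauC d j) lauD.
rewrite !E ?mulf_neq0 ?expf_neq0 // rat_comp_lau // /lau.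
have X0 n : 'X^n != 0 :> {poly K} by rewrite monic_neq0 ?monicXn.
have W0 : ((om *: 'X^w) ^+ k)%:F != 0 :> ratfun K.
  by rewrite tofrac_eq0 expf_neq0 // scaler_eq0 negb_or om0 X0.
apply/eqP; rewrite (eqr_div _ _ W0 (Xn_neq0 K (w * k))) -!tofracM tofrac_eq.
apply/eqP.
rewrite !comp_polyD !comp_polyZ !comp_polyD !comp_polyZ !comp_Xn_poly !comp_polyC.
have Einv : (eps^-1)%:P = ((eps * om ^+ k)^-1)%:P * (om ^+ k)%:P.
  by rewrite -polyCM invfM divfK // expf_neq0.
have [Eom EX] : om ^+ (2 * k) = om ^+ k * om ^+ k /\ 'X^(w * (2 * k))
  = 'X^(w * k) * 'X^(w * k) :> {poly K}.
  by rewrite mul2n -addnn mulnDr !exprD.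
have EX2 : 'X^(2 * (w * k))
  = 'X^(w * k) * 'X^(w * k) :> {poly K} by rewrite mul2n -addnn exprD.
rewrite !exprZn -!exprM EX EX2 Eom -!mul_polyC !polyCM Einv.
by move: (om ^+ k)%:P ('X^(w * k)) => u v; ring.
Qed.

End Primitive.

(** * The Chebyshev case *)

Section NormalForm.
Variable K : numClosedFieldType.
Implicit Types (A B C P Q U V W : {poly K}) (L : ratfun K).

Lemma sign_cases (s : K) : s ^+ 2 = 1 -> s = 1 \/ s = -1.
Proof. by move/eqP; rewrite sqrf_eq1 => /orP[] /eqP; [left|right]. Qed.

Lemma jouk_sign (s c : K) k : s ^+ 2 = 1
  -> ratC s * joukowski c k = joukowski (s * c) k.
Proof.
by case/sign_cases => ->; rewrite ?rmorphN rmorph1 ?mulN1r ?joukN ?mul1r.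
Qed.

Lemma chebyshev_odd a : odd a
  -> chebyshev a \Po - 'X = - chebyshev a :> {poly K}.
Proof.
move=> odd_a; apply: (ev_rat_inj (nonconstant_jouk (oner_neq0 K) (ltnSn 0))).
rewrite ev_comp !rmorphN /= ev_X -joukN !chebyshev_jouk ?oppr_eq0 ?oner_neq0 //.
by rewrite expr1n -signr_odd odd_a expr1 joukN.
Qed.

(** The shape of the two factors of z^N + 1/z^N; the sign e cannot be absorbed
    in the affine change of variable when a is even. *)
Definition cheb_form A L a s (lam d w e : K) : Prop :=
  [/\ lam != 0, w != 0, A \Po (lam *: 'X + d%:P) = e *: chebyshev a
    & L = ratC lam * joukowski w s + ratC d].

Lemma cheb_form_flip A L a s lam d w e : odd a ->
  cheb_form A L a s lam d w e -> cheb_form A L a s (- lam) d (- w) (- e).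
Proof.
move=> odd_a [l0 w0 EA EL]; split; rewrite ?oppr_eq0 //; last first.
  by rewrite EL joukN rmorphN mulrNN.
have -> : (- e) *: chebyshev a = (e *: chebyshev a) \Po - 'X.
  by rewrite comp_polyZ chebyshev_odd // scalerN scaleNr.
rewrite -EA -comp_polyA; congr (_ \Po _).
by rewrite comp_polyD comp_polyZ comp_polyX comp_polyC scaleNr scalerN.
Qed.

Lemma cheb_form_ev A L a s lam d w e : e ^+ 2 = 1
  -> cheb_form A L a s lam d w e ->
  A @@ L = joukowski (e * w ^+ a) (s * a).
Proof.
move=> e2 [l0 w0 EA ->]; rewrite -ev_affine -ev_comp EA -mul_polyC rmorphM /=.
by rewrite ev_polyC chebyshev_jouk // jouk_sign.
Qed.

Lemma cheb_form_eq A L a s lam d w e : cheb_form A L a s lam d w e ->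
  A = (e *: chebyshev a) \Po affine_inv lam d.
Proof. by case=> l0 _ <- _; rewrite -comp_polyA affineK // comp_polyXr. Qed.

(** Two even Chebyshev polynomials of the same sign are both polynomials in
    T_2 = 2 X^2 - 1, and T_2(u) = T_2(v) forces u = v or u = - v. *)
Lemma even_not_primitive A B L1 L2 a b s1 s2 lam1 d1 w1 lam2 d2 w2 (e : K) : e ^+ 2 = 1 ->
    cheb_form A L1 a s1 lam1 d1 w1 e -> cheb_form B L2 b s2 lam2 d2 w2 e ->
    ~~ odd a -> ~~ odd b -> A @@ L1 = B @@ L2 -> ~ primitive A B L1 L2.
Proof.
move=> e2 fA fB ea eb E prim.
pose G := chebyshev a./2 \Po affine_inv lam1 d1.
pose H := chebyshev b./2 \Po affine_inv lam2 d2.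
have e0 : e != 0 by rewrite -sqrf_eq0 e2 oner_neq0.
have half n : ~~ odd n -> (n./2 * 2)%N = n by move=> en;
  rewrite muln2 halfK (negbTE en) subn0.
have EA : A = (e *: chebyshev 2) \Po G.
  by rewrite (cheb_form_eq fA) /G !comp_polyZ comp_polyA chebyshev_comp half.
have EB : B = (e *: chebyshev 2) \Po H.
  by rewrite (cheb_form_eq fB) /H !comp_polyZ comp_polyA chebyshev_comp half.
have T2E P : (e *: chebyshev 2) \Po P = e *: (2%:R *: P ^+ 2 - 1).
  by rewrite /= comp_polyZ comp_polyB comp_polyZ comp_polyM !comp_polyX
    -polyC1 comp_polyC expr2.
have s3 : size (e *: chebyshev 2 : {poly K})
  = 3 by rewrite size_scale // size_chebyshev.
have : (G @@ L1) ^+ 2 = (H @@ L2) ^+ 2.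
  have t0 : ratC (e * 2%:R) != 0 by rewrite fmorph_eq0 mulf_neq0 // two_neq0.
  apply: (mulfI t0); apply: (addIr (- ratC e)).
  have TE P L : ratC (e * 2%:R) * (P @@ L) ^+ 2 - ratC e
    = ((e *: chebyshev 2) \Po P) @@ L.
    rewrite T2E -!mul_polyC [RHS]rmorphM rmorphB rmorph1 [in RHS]rmorphM rmorphXn /=.
    by rewrite !ev_polyC mulrBr mulr1 mulrA -rmorphM.
  by rewrite !TE -EA -EB.
move/eqP; rewrite eqf_sqr => /orP[] /eqP EGH.
  by have := prim _ _ _ EA EB EGH; rewrite s3.
have EB' : B = (e *: chebyshev 2) \Po (- H) by rewrite EB !T2E sqrrN.
by have := prim _ _ _ EA EB'; rewrite s3 rmorphN => /(_ EGH).
Qed.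

(** If the signs agree, one of them can be changed by X |-> - X as long as a or
    b is odd; otherwise there would be a common left factor T_2. *)
Lemma opposite_signs A B L1 L2 a b s1 s2 lam1 d1 w1 lam2 d2 w2 (e1 e2 : K) :
    e1 ^+ 2 = 1 -> e2 ^+ 2 = 1 ->
    cheb_form A L1 a s1 lam1 d1 w1 e1 -> cheb_form B L2 b s2 lam2 d2 w2 e2 ->
    A @@ L1 = B @@ L2 -> primitive A B L1 L2 ->
  exists sg l1 d1 w1 l2 d2 w2, [/\ sg ^+ 2 = 1,
    cheb_form A L1 a s1 l1 d1 w1 (- sg) & cheb_form B L2 b s2 l2 d2 w2 sg].
Proof.
move=> e1s e2s fA fB E prim.
have [Ee|Ee] : e1 = - e2 \/ e1 = e2.
  by case: (sign_cases e1s) => ->; case: (sign_cases e2s) => ->;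
    rewrite ?opprK; auto.
  by exists e2, lam1, d1, w1, lam2, d2, w2; rewrite -Ee.
subst e1; have [oa|ea] := boolP (odd a).
  by exists e2, (- lam1), d1, (- w1), lam2, d2, w2; split=> //;
    apply: cheb_form_flip.
have [ob|eb] := boolP (odd b).
  exists (- e2), lam1, d1, w1, (- lam2), d2, (- w2); rewrite sqrrN opprK.
  by split=> //; apply: cheb_form_flip.
by case: (even_not_primitive e2s fA fB ea eb E prim).
Qed.

Definition chebyshev_pair (At Bt : {poly K}) (Lt1 Lt2 : ratfun K) :=
  exists (n m l : nat) (eps : K),
  [/\ (1 <= n)%N, (1 <= m)%N, (2 < l)%N, eps ^+ (n * l)%N = -1 & coprime n m] /\
  equiv_decomp At%:F Lt1 (- chebyshev (n * l)%N)%:F (joukowski eps m) /\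
  equiv_decomp Bt%:F Lt2 (chebyshev (m * l)%N)%:F (joukowski 1 n).

(** Since n s1 = m s2 with n and m coprime, s1 = m w and s2 = n w, and z^w up
    to a constant is a common right factor W of L1 and L2. *)
Lemma chebyshev_pair_normal_form A B L1 L2 a b s1 s2 (sg l1 d1 w1 l2 d2 w2 : K) k :
    (2 < k)%N -> (k %| a)%N -> (k %| b)%N -> (0 < a)%N -> (0 < b)%N
      -> (0 < s1)%N ->
    (a * s1 = b * s2)%N -> sg ^+ 2 = 1 -> cheb_form A L1 a s1 l1 d1 w1 (- sg) ->
    cheb_form B L2 b s2 l2 d2 w2 sg -> A @@ L1 = B @@ L2 ->
  exists W Lt1 Lt2, [/\ nonconstant W%:F,
    [/\ nonconstant Lt1, nonconstant Lt2, Laurent Lt1 & Laurent Lt2],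
    [/\ L1 = rat_comp Lt1 W%:F, L2 = rat_comp Lt2 W%:F &
        rat_comp (sg *: A)%:F Lt1 = rat_comp (sg *: B)%:F Lt2]
    & chebyshev_pair (sg *: A) (sg *: B) Lt1 Lt2].
Proof.
move=> k_gt2 ka kb a_gt0 b_gt0 s1_gt0 Eab sg2 fA fB E.
pose l := gcdn a b; have l_gt0 : (0 < l)%N by rewrite gcdn_gt0 a_gt0.
have [n Ea] := dvdnP (dvdn_gcdl a b); have [m Eb] := dvdnP (dvdn_gcdr a b).
rewrite -/l in Ea Eb.
have n_gt0 : (0 < n)%N by move: a_gt0; rewrite Ea muln_gt0 => /andP[].
have m_gt0 : (0 < m)%N by move: b_gt0; rewrite Eb muln_gt0 => /andP[].
have cop : coprime n m.
  rewrite /coprime -(eqn_pmul2r l_gt0) mul1n muln_gcdl -Ea -Eb; exact: eqxx.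
have Enm : (n * s1 = m * s2)%N.
  by apply/eqP; rewrite -(eqn_pmul2r l_gt0) mulnAC -Ea Eab Eb mulnAC.
have /dvdnP[w Es1] : (m %| s1)%N by rewrite -(Gauss_dvdr _ (_ : coprime m n))
  ?Enm ?dvdn_mulr // coprime_sym.
have Es2 : s2 = (w * n)%N.
  by apply/eqP; rewrite -(eqn_pmul2l m_gt0) -Enm Es1; apply/eqP; clear; lia.
have w_gt0 : (0 < w)%N by move: s1_gt0; rewrite Es1 muln_gt0 => /andP[].
have l_gt2 : (2 < l)%N by apply: leq_trans k_gt2 _;
  rewrite dvdn_leq // dvdn_gcd ka.
have E1 := cheb_form_ev (_ : (- sg) ^+ 2 = 1) fA;
  have E2 := cheb_form_ev sg2 fB.
have [l10 w10 EA EL1] := fA; have [l20 w20 EB EL2] := fB.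
pose om := n.-root w2; have omn : om ^+ n = w2 by rewrite rootCK.
have om0 : om != 0 by apply: contraNneq w20 => o0;
  rewrite -omn o0 expr0n gtn_eqF.
pose eps := w1 / om ^+ m.
have eps0 : eps != 0 by rewrite mulf_neq0 ?invr_eq0 ?expf_neq0.
have sg0 : sg != 0 by rewrite -sqrf_eq0 sg2 oner_neq0.
have sgK : sg * sg = 1 by rewrite -expr2.
have eps_a : eps ^+ a = -1.
  have : - sg * w1 ^+ a = sg * w2 ^+ b.
    apply: (@jouk_inj _ _ _ (b * s2));
      rewrite ?mulf_neq0 ?oppr_eq0 ?expf_neq0 //.
      by rewrite -Eab muln_gt0 a_gt0.
    by rewrite -{1}Eab mulnC -E1 ?sqrrN // E E2 mulnC.
  rewrite mulNr -mulrN => /(mulfI sg0) Ew.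
  rewrite /eps expr_div_n -exprM {2}Ea mulnCA (_ : (m * l = b)%N) // exprM omn.
  by rewrite -Ew invrN mulrN divff // expf_neq0.
exists (om *: 'X^w), (ratC l1 * joukowski eps m + ratC d1),
  (ratC l2 * joukowski 1 n + ratC d2).
have nJ1 := nonconstant_jouk eps0 m_gt0;
  have nJ2 := nonconstant_jouk (oner_neq0 K) n_gt0.
have EA' : (sg *: A) \Po (l1 *: 'X + d1%:P) = - chebyshev (n * l).
  by rewrite comp_polyZ EA scalerA mulrN sgK scaleN1r Ea.
have EB' : (sg *: B) \Po (l2 *: 'X + d2%:P) = chebyshev (m * l).
  by rewrite comp_polyZ EB scalerA sgK scale1r Eb.
split.
- by apply/nonconstant_poly; rewrite size_scale // size_polyXn ltnS.
- rewrite -!ev_affine; split; try by apply: nonconstant_ev;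
  rewrite ?size_affine.
    by apply/Laurent_ev/Laurent_jouk.
  by apply/Laurent_ev/Laurent_jouk/oner_neq0.
- rewrite !rat_comp_affine_jouk ?oner_neq0 // mul1r omn divfK ?expf_neq0 //.
  rewrite -Es1 -Es2 EL1 EL2 -!ev_affine; split=> //.
  rewrite !rat_comp_polyl; try by apply: nonconstant_ev; rewrite ?size_affine.
  rewrite -!ev_comp EA' EB' rmorphN /= !chebyshev_jouk
    ?oner_neq0 // expr1n -Ea eps_a.
  by rewrite joukN opprK Ea mulnCA.
exists n, m, l, eps; split; first by split; rewrite -?Ea.
split; apply: equiv_decomp_affine => //;
  rewrite ?size_polyN size_chebyshev ltnS muln_gt0.
  by rewrite n_gt0.
by rewrite m_gt0.
Qed.

End NormalForm.

Section ReducibleCase.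
Variable K : numClosedFieldType.
Implicit Types (A B C P Q U V W : {poly K}) (L : ratfun K).

(** The equation would make 1 - X^2, which has simple roots, a square. *)
Lemma T2_not_opposite (h : {poly K}) : chebyshev 2 \Po h <> - chebyshev 2.
Proof.
rewrite /= comp_polyB comp_polyZ comp_polyM !comp_polyX -polyC1 comp_polyC => E.
have two0 := @two_neq0 K.
have {}E : h ^+ 2 + 'X ^+ 2 = 1.
  have t0 : (2%:R)%:P != 0 :> {poly K} by rewrite polyC_eq0.
  apply: (mulfI t0); rewrite mulrDr !mul_polyC !expr2; apply: (addIr (- 1%:P)).
  rewrite addrAC E opprB subrK -mul_polyC polyC1 mulr1 -polyC1 -polyCB.
  by rewrite mulr2n addrK.
have h1 : h.[1] = 0.
  move/(congr1 (horner^~ 1)): E;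
    rewrite hornerD !horner_exp hornerX hornerC expr1n.
  by move/eqP; rewrite -subr_eq0 addrK sqrf_eq0 => /eqP.
move/(congr1 (fun p : {poly K} => p^`().[1])): E.
rewrite !expr2 derivD !derivM derivX derivC !hornerD !hornerM !hornerX !hornerC h1.
by rewrite mulr0 mul0r !add0r mulr1 => /eqP; rewrite -mulr2n (negbTE two0).
Qed.

Lemma comp_poly_injr P C1 C2 : size P = 2 -> P \Po C1 = P \Po C2 -> C1 = C2.
Proof.
move=> sP; have P1 : P`_1 != 0.
  by have := lead_coef_eq0 P; rewrite lead_coefE sP -size_poly_eq0 sP => ->.
have -> : P = P`_1 *: 'X + (P`_0)%:P.
  apply/polyP => -[|[|i]];
    rewrite coefD coefZ coefX coefC /= ?mulr0 ?mulr1 ?add0r ?addr0 //.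
  by rewrite nth_default // sP.
rewrite !comp_polyD !comp_polyZ !comp_polyX !comp_polyC => /addIr.
by apply: scalerI.
Qed.

(** Reducibility provides A = A1 o U and B = B1 o V with deg A1 = deg B1, hence
    M1 = U o L1 and M2 = V o L2 that form a pair for polynomials of equal degree.
    If M1 were affine in M2, A1 would be a common left factor.  So M1 and M2
    are z^k + 1/z^k up to scaling, and A1, B1 are both polynomials in T_m, where
    primitivity forces m = deg A1. *)
Lemma primitive_reducible A B L1 L2 : (1 < size A)%N -> (1 < size B)%N ->
    Laurent L1 -> Laurent L2 -> nonconstant L1 -> nonconstant L2 ->
    A @@ L1 = B @@ L2 -> primitive A B L1 L2 -> splits A B ->
  exists P A' B' m g N, [/\ A = P \Po A', B = P \Po B', size P = 2,
    [/\ (2 < m)%N, (m %| (size A').-1)%N & (m %| (size B').-1)%N] &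
    [/\ g != 0, (0 < N)%N,
      A' @@ L1 = joukowski g N & B' @@ L2 = joukowski g N]].
Proof.
move=> sA sB Lau1 Lau2 nL1 nL2 E prim spl.
have [A1 [B1 [U [V [EA EB sAB sA1 spl1]]]]] := splits_equal_degree sA sB spl.
have [sA1_3 deg3] := splits_degree sA1 spl1.
have [n sA1n] : exists n, size A1 = n.+2 by case: (size A1) sA1 =>
  [|[|n]] // _; exists n.
have nA : nonconstant (A @@ L1) by exact: nonconstant_ev.
have nM1 : nonconstant (U @@ L1).
  move=> c Ec; apply: (nA A1.[c]); rewrite EA ev_comp Ec.
  by rewrite -[ratC c](ev_polyC (@ratC K) L1) -ev_comp comp_polyCr ev_polyC.
have E1 : A1 @@ (U @@ L1) = B1 @@ (V @@ L2) by rewrite -!ev_comp -EA -EB.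
have sB1n : size B1 = n.+2 by rewrite -sAB.
have nM2 : nonconstant (V @@ L2).
  move=> c Ec; apply: (nA B1.[c]); rewrite E EB ev_comp Ec.
  by rewrite -[ratC c](ev_polyC (@ratC K) L1) -ev_comp comp_polyCr ev_polyC.
have [[c [c0 EM]]|] := two_pole_pair sA1n sB1n (Laurent_ev U Lau1) (Laurent_ev V Lau2) nM1 E1.
  have EB1 : B1 = A1 \Po (c *: 'X + c0%:P).
    by apply: (ev_rat_inj nM2); rewrite -E1 EM ev_comp ev_affine.
  have := prim A1 U ((c *: 'X + c0%:P) \Po V) EA.
  rewrite leqNgt sA1_3 => H; suff : false by []; apply: H.
    by rewrite EB EB1 comp_polyA.
  by rewrite EM ev_comp ev_affine.
(* M1 and M2 have two poles and are scaled differently. *)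
case=> k [l1 [z1 [c1 [l2 [z2 [c2 [k_gt0 [l10 z10 l20 z20] nz EM1 EM2]]]]]]].
pose A2 := A1 \Po (l1 *: 'X + c1%:P); pose B2 := B1 \Po (l2 *: 'X + c2%:P).
have sA2 : size A2 = n.+2 by rewrite size_comp_poly2 ?size_affine.
have E2 : A2 @@ joukowski z1 k = B2 @@ joukowski z2 k.
  by rewrite !ev_comp !ev_affine -EM1 -EM2.
have [|m [s [P [m_gt1 s2 Ez EA2 EB2]]]] := jouk_pair _ z10 z20 k_gt0 nz E2;
  first by rewrite sA2.
pose A' := chebyshev m \Po (affine_inv l1 c1 \Po U).
pose B' := (s *: chebyshev m) \Po (affine_inv l2 c2 \Po V).
have affine_sub l c C : l != 0
  -> (l *: 'X + c%:P) \Po (affine_inv l c \Po C) = C.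
  by move=> l0; rewrite comp_polyA affineK // comp_polyX.
have EA' : A = P \Po A'.
  by rewrite /A' comp_polyA -EA2 /A2 -comp_polyA affine_sub.
have EB' : B = P \Po B' by rewrite /B' comp_polyA -EB2 /B2 -comp_polyA affine_sub.
have EJ1 : (affine_inv l1 c1 \Po U) @@ L1 = joukowski z1 k.
  by rewrite ev_comp EM1 -ev_affine -ev_comp affine_invK // ev_X.
have EJ2 : (affine_inv l2 c2 \Po V) @@ L2 = joukowski z2 k.
  by rewrite ev_comp EM2 -ev_affine -ev_comp affine_invK // ev_X.
have JA : A' @@ L1 = joukowski (z1 ^+ m) (k
  * m) by rewrite ev_comp EJ1 chebyshev_jouk.
have JB : B' @@ L2 = joukowski (z1 ^+ m) (k * m).
  rewrite ev_comp EJ2 -mul_polyC rmorphM /= ev_polyC chebyshev_jouk //.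
  by rewrite jouk_sign // Ez.
have sP : size P = 2.
  have := prim P A' B' EA' EB' (etrans JA (esym JB)).
  have : size (P \Po A') = (size A).-1.+1 by rewrite -EA' prednK // ltnW.
  move/degree_comp => /(_ _)[|p [q [-> _ p_gt0 _ _]]];
    first by rewrite -ltnS prednK // ltnW.
  by rewrite ltnS => p1; congr _.+1; apply/eqP; rewrite eqn_leq p1.
have m_n : m = n.+1.
  have := size_comp_poly P (chebyshev m);
    rewrite -EA2 sA2 sP size_chebyshev /= mul1n.
  by move->.
have m_gt2 : (2 < m)%N.
  rewrite ltn_neqAle m_gt1 andbT; apply/eqP => m2.
  (* If m = 2, the factors of A1(X) - B1(Y) have degree 1 in X. *)
  have [h Eh] : exists h, B1 = A1 \Po h by apply: deg3; rewrite sA1n -m_n -m2.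
  have s_1 : s = -1.
    by case: (sign_cases s2) => // s1; case/eqP: nz; rewrite m2 Ez s1 mul1r.
  apply: (@T2_not_opposite (affine_inv l1 c1 \Po (h \Po (l2 *: 'X + c2%:P)))).
  apply: (comp_poly_injr sP);
    rewrite comp_polyA m2 -EA2 /A2 -comp_polyA affine_sub //.
  by rewrite comp_polyA -Eh -/B2 EB2 s_1 scaleN1r.
exists P, A', B', m, (z1 ^+ m), (k * m)%N; split=> //.
  split=> //; rewrite size_comp_poly ?size_scale ?size_chebyshev ?dvdn_mulr //.
  by rewrite -sqrf_eq0 s2 oner_neq0.
by split=> //; rewrite ?expf_neq0 // muln_gt0 k_gt0 ltnW.
Qed.
End ReducibleCase.

(** * Proof of the theorem *)

Section Conclusion.
Variable K : numClosedFieldType.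
Implicit Types (A B C P Q U V W : {poly K}) (L : ratfun K).

Lemma primitive_reducible_chebyshev A B L1 L2 : (1 < size A)%N
  -> (1 < size B)%N ->
    Laurent L1 -> Laurent L2 -> nonconstant L1 -> nonconstant L2 ->
    A @@ L1 = B @@ L2 -> primitive A B L1 L2 -> splits A B ->
  exists P At Bt W Lt1 Lt2, [/\ A = P \Po At, B = P \Po Bt, nonconstant W%:F,
    [/\ nonconstant Lt1, nonconstant Lt2, Laurent Lt1 & Laurent Lt2] &
    [/\ L1 = rat_comp Lt1 W%:F, L2 = rat_comp Lt2 W%:F,
        rat_comp At%:F Lt1 = rat_comp Bt%:F Lt2
      & chebyshev_pair At Bt Lt1 Lt2]].
Proof.
move=> sA sB Lau1 Lau2 nL1 nL2 E prim spl.
have [P [A' [B' [m [g [N [EA EB sP [m_gt2 mA mB] [g0 N_gt0 JA JB]]]]]]]] :=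
  primitive_reducible sA sB Lau1 Lau2 nL1 nL2 E prim spl.
have prim' : primitive A' B' L1 L2.
  move=> Q A'' B'' EA'' EB'' E''; have := prim (P \Po Q) A'' B''.
  rewrite -!comp_polyA -EA'' -EB'' => /(_ EA EB E'') sPQ.
  have := size_comp_poly P Q; rewrite sP mul1n.
  by move: sPQ; move: (size _) (size Q) => p q; clear; lia.
have nJ : nonconstant (joukowski g N) by exact: nonconstant_jouk.
have sA' : (1 < size A')%N by apply: (@ev_size_gt1 _ _ L1); rewrite JA.
have sB' : (1 < size B')%N by apply: (@ev_size_gt1 _ _ L2); rewrite JB.
have [a sA'a] : exists a, size A' = a.+2 by case: (size A') sA' =>
  [|[|a]] // _; exists a.
have [b sB'b] : exists b, size B' = b.+2 by case: (size B') sB' =>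
  [|[|b]] // _; exists b.
rewrite sA'a /= in mA; rewrite sB'b /= in mB.
have [s1 [l1 [w1 [d1 [e1 [Es1 [l10 w10] e1s EA' EL1]]]]]] :=
  jouk_decomposition sA'a isT N_gt0 g0 Lau1 nL1 JA.
have [s2 [l2 [w2 [d2 [e2 [Es2 [l20 w20] e2s EB' EL2]]]]]] :=
  jouk_decomposition sB'b isT N_gt0 g0 Lau2 nL2 JB.
have JAB : A' @@ L1 = B' @@ L2 by rewrite JA JB.
have fA : cheb_form A' L1 a.+1 s1 l1 d1 w1 e1 by split.
have fB : cheb_form B' L2 b.+1 s2 l2 d2 w2 e2 by split.
have [sg [k1 [d1' [x1 [k2 [d2' [x2 [sg2 fA' fB']]]]]]]] :=
  opposite_signs e1s e2s fA fB JAB prim'.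
have s1_gt0 : (0 < s1)%N by move: N_gt0; rewrite -Es1 muln_gt0 => /andP[].
have [W [Lt1 [Lt2 [nW nL [E1 E2 E3] cp]]]] :=
  chebyshev_pair_normal_form m_gt2 mA mB
  (ltn0Sn a) (ltn0Sn b) s1_gt0 (etrans Es1 (esym Es2)) sg2 fA' fB' JAB.
have unsign C : (P \Po (sg *: 'X)) \Po (sg *: C) = P \Po C.
  by rewrite -comp_polyA comp_polyZ comp_polyX scalerA -expr2 sg2 scale1r.
by exists (P \Po (sg *: 'X)), (sg *: A'), (sg *: B'), W, Lt1, Lt2;
  rewrite !unsign.
Qed.

Lemma nonconstant_factors P Q : nonconstant (P \Po Q)%:F ->
  nonconstant P%:F /\ nonconstant Q%:F.
Proof.
move/nonconstant_poly => sPQ.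
have [n sn] : exists n, size (P \Po Q) = n.+2 by case: (size _) sPQ =>
  [|[|n]] // _; exists n.
have [p [q [sp sq p_gt0 q_gt0 _]]] := degree_comp sn isT.
by split; apply/nonconstant_poly; rewrite ?sp ?sq ltnS.
Qed.

Lemma nonconstant_comp P Q : nonconstant P%:F -> nonconstant Q%:F ->
  nonconstant (P \Po Q)%:F.
Proof.
rewrite !nonconstant_poly => sP sQ; have := size_comp_poly P Q.
have : (0 < (size P).-1 * (size Q).-1)%N by rewrite muln_gt0;
  case: (size P) (size Q) sP sQ => [|[|p]] [|[|q]].
by move=> pq_gt0 Epq; rewrite -Epq in pq_gt0; case: (size _) pq_gt0 => [|[|n]].
Qed.

Theorem composite_laurent A B L1 L2 : nonconstant A%:F -> nonconstant B%:F ->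
    nonconstant L1 -> nonconstant L2 -> Laurent L1 -> Laurent L2 ->
    rat_comp A%:F L1 = rat_comp B%:F L2 ->
  exists (Q At Bt W : {poly K}) (Lt1 Lt2 : ratfun K),
    [/\ nonconstant Q%:F, nonconstant At%:F,
      nonconstant Bt%:F & nonconstant W%:F] /\
    [/\ nonconstant Lt1, nonconstant Lt2, Laurent Lt1 & Laurent Lt2] /\
    [/\ A = Q \Po At, B = Q \Po Bt, L1 = rat_comp Lt1 W%:F,
      L2 = rat_comp Lt2 W%:F
      & rat_comp At%:F Lt1 = rat_comp Bt%:F Lt2] /\
    (irreducible_pair At Bt \/ chebyshev_pair At Bt Lt1 Lt2).
Proof.
move=> nA nB nL1 nL2 Lau1 Lau2; rewrite !rat_comp_polyl // => E.
have sA : (1 < size A)%N by exact/nonconstant_poly.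
have [Q [A' [B' [EA EB E' prim]]]] := primitive_exists sA E.
have [nQ nA'] : nonconstant Q%:F /\ nonconstant A'%:F.
  by apply: nonconstant_factors; rewrite -EA.
have [_ nB'] : nonconstant Q%:F /\ nonconstant B'%:F.
  by apply: nonconstant_factors; rewrite -EB.
have [irr|red] := pselect (irreducible_pair A' B').
  exists Q, A', B', 'X, L1, L2; rewrite !rat_comp_X !rat_comp_polyl //.
  by do !split=> //; [apply/nonconstant_poly; rewrite size_polyX | left].
have sA' : (1 < size A')%N by exact/nonconstant_poly.
have sB' : (1 < size B')%N by exact/nonconstant_poly.
have [P [At [Bt [W [Lt1 [Lt2 [EA' EB' nW nL [E1 E2 E3 cp]]]]]]]] :=
  primitive_reducible_chebyshev sA' sB' Lau1 Lau2 nL1 nL2 E' prim (reducible_splits sA' red).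
have [nP nAt] : nonconstant P%:F /\ nonconstant At%:F.
  by apply: nonconstant_factors; rewrite -EA'.
have [_ nBt] : nonconstant P%:F /\ nonconstant Bt%:F.
  by apply: nonconstant_factors; rewrite -EB'.
exists (Q \Po P), At, Bt, W, Lt1, Lt2; rewrite -!comp_polyA -EA' -EB'.
do !split=> //; last by right.
exact: nonconstant_comp.
Qed.
End Conclusion.

Theorem theorem7p2 (R : realType) (A B : {poly R[i]}) (L1 L2 : ratfun R[i])
    (hA : nonconstant A%:F) (hB : nonconstant B%:F)
    (hL1 : nonconstant L1) (hL2 : nonconstant L2)
    (hL1p : Laurent L1) (hL2p : Laurent L2)
    (heq : rat_comp A%:F L1 = rat_comp B%:F L2)
    (hred : reducible_pair A B) :
  exists (Q At Bt W : {poly R[i]}) (Lt1 Lt2 : ratfun R[i]),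
    [/\ nonconstant Q%:F, nonconstant At%:F, nonconstant Bt%:F
      & nonconstant W%:F] /\
    [/\ nonconstant Lt1, nonconstant Lt2, Laurent Lt1 & Laurent Lt2] /\
    [/\ A = Q \Po At, B = Q \Po Bt,
        L1 = rat_comp Lt1 W%:F, L2 = rat_comp Lt2 W%:F
      & rat_comp At%:F Lt1 = rat_comp Bt%:F Lt2] /\
    (irreducible_pair At Bt \/
     exists (n m l : nat) (eps : R[i]),
       [/\ (1 <= n)%N, (1 <= m)%N, (2 < l)%N,
           eps ^+ (n * l)%N = -1 & coprime n m] /\
       equiv_decomp At%:F Lt1
         (- chebyshev (n * l)%N)%:F (joukowski eps m) /\
       equiv_decomp Bt%:F Lt2
         (chebyshev (m * l)%N)%:F (joukowski 1 n)).
Proof.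
exact: (@composite_laurent R[i] A B L1 L2 hA hB hL1 hL2 hL1p hL2p heq).
Qed.
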